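(* Let $n\ge1$, $1\le p<\infty$, $0<q\le\infty$, $\frac np<\lambda<\frac np+1$, and $\alpha=\lambda-\frac np$. Then $$\|f\|_{C_{p,q}^\lambda}\asymp\|f\|_{B_{\infty,q}^\alpha},$$ i.e. there are constants $c,C>0$, independent of $f$, with $c\|f\|_{B_{\infty,q}^\alpha}\le\|f\|_{C_{p,q}^\lambda}\le C\|f\|_{B_{\infty,q}^\alpha}$ (in particular one side is finite iff the other is).
   Context: Functions are measurable on $\mathbb R^n$, identified when equal a.e. $B_r(x)$ is the ball of radius $r$ centered at $x$, and $A_rf(x)=\frac1{|B_r|}\int_{B_r(x)}f(y)\,dy$. Campanato quasi-norm, for $f\in L_p^{\mathrm{loc}}(\mathbb R^n)$: $\|f\|_{C_{p,q}^\lambda}=|f|_{C_{p,q}^\lambda}+\sup_{x\in\mathbb R^n}\|f\|_{L_p(B_1(x))}$, where $$|f|_{C_{p,q}^\lambda}=\bigg(\int_0^\infty\bigg(r^{-\lambda}\sup_{x\in\mathbb R^n}\Big(\int_{B_r(x)}|f(y)-A_rf(x)|^p\,dy\Big)^{1/p}\bigg)^q\frac{dr}r\bigg)^{1/q}$$ (with $\sup_{r>0}$ replacing the integral if $q=\infty$). Besov quasi-norm, for $0<\alpha<1$: $\|f\|_{B_{\infty,q}^\alpha}=\big(\int_0^1(t^{-\alpha}\omega(f,t)_\infty)^q\frac{dt}t\big)^{1/q}+\|f\|_{L_\infty(\mathbb R^n)}$ (with $\sup_{0<t<1}$ replacing the integral if $q=\infty$), where $\omega(f,t)_\infty=\sup_{|y|\le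 t}\|f(\cdot+y)-f(\cdot)\|_{L_\infty}$. *)

(* Defs.v *)
From HB Require Import structures.
From mathcomp Require Import all_boot all_order all_algebra.
From mathcomp Require Import all_classical all_reals all_analysis.

Set Implicit Arguments.
Unset Strict Implicit.
Unset Printing Implicit Defensive.

Import Order.TTheory GRing.Theory Num.Theory.
Import numFieldNormedType.Exports.

Local Open Scope classical_set_scope.
Local Open Scope ring_scope.

Definition rV_display : measure_display -> measure_display.
Proof. exact. Qed.

(* The sigma-algebra of 'rV[R]_n is the one generated by the n coordinates,   *)
(* i.e. the Borel sigma-algebra of R^n.                                       *)
Section measurable_rV.
Context (R : realType) (n : nat).

Let coord : 'I_n -> 'rV[R]_n -> measurableTypeR R := fun i x => x ord0 i.

Let rV_set0 : g_sigma_preimage coord set0.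
Proof. exact: sigma_algebra0. Qed.

Let rV_setC A : g_sigma_preimage coord A -> g_sigma_preimage coord (~` A).
Proof. exact: sigma_algebraC. Qed.

Let rV_bigcup (F : (set 'rV[R]_n)^nat) :
  (forall i, g_sigma_preimage coord (F i)) ->
  g_sigma_preimage coord (\bigcup_i (F i)).
Proof. exact: sigma_algebra_bigcup. Qed.

HB.instance Definition _ := @isMeasurable.Build
  (rV_display default_measure_display)
  'rV[R]_n (g_sigma_preimage coord) rV_set0 rV_setC rV_bigcup.

End measurable_rV.

Lemma measurable_coord_rV (R : realType) n (i : 'I_n) :
  measurable_fun [set: 'rV[R]_n] (fun x => x ord0 i).
Proof.
move=> _ Y mY; rewrite setTI; apply: sub_sigma_algebra => /=.
rewrite -bigcup_seq/=; exists i => /=; first by rewrite mem_index_enum.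
by exists Y => //; rewrite setTI.
Qed.

Lemma measurable_fun_rVP (R : realType) d (T : measurableType d) n
    (f : T -> 'rV[R]_n) :
  measurable_fun [set: T] f <->
  forall i, measurable_fun [set: T] (fun t => f t ord0 i).
Proof.
split=> [mf i|mf].
  exact: (measurableT_comp (@measurable_coord_rV R n i) mf).
move=> _ Y; apply: (smallest_sub (C := sigma_algebra setT)
    (X := [set B : set 'rV[R]_n | measurable (setT `&` f @^-1` B)])).
  split => /=.
  - by rewrite preimage_set0 setI0.
  - move=> A mA /=; rewrite setTI setTD preimage_setC; apply: measurableC.
    by rewrite -[X in measurable X]setTI.
  - move=> F mF /=; rewrite setTI preimage_bigcup; apply: bigcup_measurable.
    by move=> k _; rewrite -[X in measurable X]setTI; exact: mF.
rewrite -bigcup_seq => B [i _ [A mA <-]] /=.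
by rewrite !setTI; have := mf i measurableT A mA; rewrite setTI.
Qed.

Definition cons_rV (R : realType) n (z : measurableTypeR R * 'rV[R]_n) :
    'rV[R]_n.+1 :=
  \row_i oapp (fun j => z.2 ord0 j) (z.1 : R) (unlift ord0 i).

Lemma measurable_cons_rV (R : realType) n :
  measurable_fun [set: measurableTypeR R * 'rV[R]_n] (@cons_rV R n).
Proof.
apply/measurable_fun_rVP => i; rewrite /cons_rV.
under eq_fun do rewrite mxE.
case: unliftP => [j|] _ /=; last exact: measurable_fst.
exact: (measurableT_comp (@measurable_coord_rV R n j) measurable_snd).
Qed.

Definition uncons_rV (R : realType) n (x : 'rV[R]_n.+1) :
    measurableTypeR R * 'rV[R]_n :=
  (x ord0 ord0, \row_j x ord0 (lift ord0 j)).

Lemma cons_rVK (R : realType) n : cancel (@cons_rV R n) (@uncons_rV R n).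
Proof.
case=> a y; congr pair; first by rewrite /cons_rV mxE unlift_none.
by apply/rowP => j; rewrite !mxE liftK.
Qed.

Lemma uncons_rVK (R : realType) n : cancel (@uncons_rV R n) (@cons_rV R n).
Proof.
move=> x; apply/rowP => i; rewrite mxE.
by case: unliftP => [j|] -> //=; rewrite mxE.
Qed.

Lemma measurable_uncons_rV (R : realType) n :
  measurable_fun [set: 'rV[R]_n.+1] (@uncons_rV R n).
Proof.
apply/measurable_fun_pairP; split; first exact: measurable_coord_rV.
apply/measurable_fun_rVP => j; under eq_fun do rewrite mxE.
exact: measurable_coord_rV.
Qed.

(* lebesgue_rV R n is the n-fold product of the Lebesgue measure on R,        *)
(* transported along R * R^n = R^(n+1).                                       *)
Section lebesgue_rV_step.
Context (R : realType) (n : nat).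
Variable m : {sigma_finite_measure set 'rV[R]_n -> \bar R}.
Local Open Scope ereal_scope.

Definition lebesgue_rV_step : set 'rV[R]_n.+1 -> \bar R :=
  pushforward (@lebesgue_measure R \x m) (@cons_rV R n).

Let step0 : lebesgue_rV_step set0 = 0.
Proof. by rewrite /lebesgue_rV_step /pushforward preimage_set0 measure0. Qed.

Let step_ge0 A : 0 <= lebesgue_rV_step A.
Proof. by rewrite /lebesgue_rV_step /pushforward measure_ge0. Qed.

Let step_sigma_additive : semi_sigma_additive lebesgue_rV_step.
Proof.
move=> F mF tF mUF; rewrite /lebesgue_rV_step /pushforward preimage_bigcup.
have mcons B : measurable B -> measurable (@cons_rV R n @^-1` B).
  by move=> mB; rewrite -[X in measurable X]setTI; exact: measurable_cons_rV.
apply: measure_semi_sigma_additive.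
- by move=> k; exact: mcons.
- apply/trivIsetP => /= i j _ _ ij; rewrite -preimage_setI.
  by move/trivIsetP : tF => /(_ _ _ _ _ ij) ->//; rewrite preimage_set0.
- by rewrite -preimage_bigcup; exact: mcons.
Qed.

HB.instance Definition _ := isMeasure.Build _ _ _ lebesgue_rV_step
  step0 step_ge0 step_sigma_additive.

Let step_sigma_finite : sigma_finite setT lebesgue_rV_step.
Proof.
have /sigma_finiteP[F [TF ndF Foo]] := sigma_finiteT (@lebesgue_measure R).
have /sigma_finiteP[G [TG ndG Goo]] := sigma_finiteT m.
exists (fun k => @uncons_rV R n @^-1` (F k `*` G k)).
  apply/esym; rewrite -subTset => x _.
  have : setT (uncons_rV x).1 by []. rewrite TF => -[i _ Fi].
  have : setT (uncons_rV x).2 by []. rewrite TG => -[j _ Gj].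
  exists (maxn i j) => //; split.
  - by move: Fi; apply: (subsetPset _ _ (ndF _ _ (leq_maxl i j))).
  - by move: Gj; apply: (subsetPset _ _ (ndG _ _ (leq_maxr i j))).
move=> k; have [mF Fk] := Foo k; have [mG Gk] := Goo k.
have mFG := measurableX mF mG; split.
  by rewrite -[X in measurable X]setTI; exact: measurable_uncons_rV.
rewrite /lebesgue_rV_step /pushforward -comp_preimage.
rewrite (_ : _ \o _ = id) ?preimage_id//.
  by rewrite product_measure1E// lte_mul_pinfty// ge0_fin_numE.
by apply/funext => z /=; rewrite cons_rVK.
Qed.

HB.instance Definition _ := Measure_isSigmaFinite.Build _ _ _
  lebesgue_rV_step step_sigma_finite.

End lebesgue_rV_step.

Fixpoint lebesgue_rV (R : realType) n :
    {sigma_finite_measure set 'rV[R]_n -> \bar R} :=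
  if n is n'.+1 then
    [the sigma_finite_measure _ _ of lebesgue_rV_step (lebesgue_rV R n')]
  else [the sigma_finite_measure _ _ of @dirac _ 'rV[R]_0 0 R].

Lemma lebesgue_rV_box (R : realType) n (a b : 'rV[R]_n) :
  (forall i, a ord0 i <= b ord0 i) ->
  lebesgue_rV R n [set x | forall i, a ord0 i <= x ord0 i <= b ord0 i] =
  (\prod_i (b ord0 i - a ord0 i))%:E.
Proof.
elim: n => [|n IHn] in a b * => ab.
  by rewrite big_ord0 /= diracE mem_set//= => -[].
have -> : lebesgue_rV R n.+1 = lebesgue_rV_step (lebesgue_rV R n)
  :> (set _ -> \bar R) by [].
rewrite /lebesgue_rV_step /pushforward.
set a' := (uncons_rV a).2; set b' := (uncons_rV b).2.
pose I0 : set (measurableTypeR R) := `[a ord0 ord0, b ord0 ord0]%classic.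
pose B : set 'rV[R]_n := [set x | forall i, a' ord0 i <= x ord0 i <= b' ord0 i].
have -> : @cons_rV R n @^-1`
    [set x | forall i, a ord0 i <= x ord0 i <= b ord0 i] = I0 `*` B.
  apply/seteqP; split=> -[x y] /=.
    move=> h; split; first by have := h ord0; rewrite mxE unlift_none /I0 /= in_itv.
    by move=> i; have := h (lift ord0 i); rewrite !mxE liftK.
  move=> [x0 h] i; rewrite mxE; case: unliftP => [j ->|->] /=.
    by have := h j; rewrite !mxE.
  by move: x0; rewrite /I0 /= in_itv.
have mB : measurable B.
  rewrite [X in measurable X](_ : _ = \bigcap_(i in [set: 'I_n])
      ((fun x : 'rV[R]_n => x ord0 i : R) @^-1` `[a' ord0 i, b' ord0 i])).
    apply: fin_bigcap_measurable => // i _.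
    rewrite -[X in measurable X]setTI.
    exact: measurable_coord_rV.
  apply/seteqP; split => x /= h i; first by move=> _; rewrite /= in_itv /= h.
  by have := h i I; rewrite /= in_itv.
have IHB : lebesgue_rV R n B = (\prod_i (b' ord0 i - a' ord0 i))%:E.
  by apply: IHn => i; rewrite !mxE.
transitivity (lebesgue_measure I0 * lebesgue_rV R n B)%E.
  by apply: product_measure1E => //; exact: measurable_itv.
rewrite IHB big_ord_recl EFinM [X in (X * _)%E = _]lebesgue_measure_itv /= lte_fin.
congr (_ * _)%E; last by congr EFin; apply: eq_bigr => i _; rewrite !mxE.
case: ltP => [_|ba]; first by rewrite EFinB.
by congr EFin; apply/esym/eqP; rewrite subr_eq0 eq_le ba ab.
Qed.

Section spaces.
Context (R : realType) (n : nat).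
Implicit Types (f : 'rV[R]_n -> R) (x y : 'rV[R]_n) (r t p lambda alpha : R).
Implicit Types (D : set 'rV[R]_n) (q : \bar R) (I : set R) (g : R -> \bar R).

Local Notation mu := (lebesgue_rV R n).

(* The library norm `|x| on 'rV[R]_n is the max norm. *)
Definition euclid_norm x : R := Num.sqrt (\sum_i x ord0 i ^+ 2).

Definition euclid_ball x r : set 'rV[R]_n := [set y | euclid_norm (y - x) < r].

Definition Lp_norm p D f : \bar R :=
  ((\int[mu]_(y in D) (`|f y| `^ p)%:E) `^ p^-1)%E.

Definition Linf_norm f : \bar R := Lnorm mu +oo%E (EFin \o f).

Definition Lp_loc p f : Prop :=
  measurable_fun [set: 'rV[R]_n] f /\
  forall K : set 'rV[R]_n, compact K -> (Lp_norm p K f < +oo)%E.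

Definition average r f x : R :=
  (fine (mu (euclid_ball x r)))^-1 * \int[mu]_(y in euclid_ball x r) f y.

(* The L_q quasi-norm of g on I with respect to dt/t, used for 0 < q <= +oo;  *)
(* the value at q = -oo is junk.                                              *)
Definition Lq_dtt q I g : \bar R :=
  match q with
  | r%:E => ((\int[lebesgue_measure]_(t in I) (g t `^ r * t^-1%:E)) `^ r^-1)%E
  | _ => ereal_sup [set g t | t in I]
  end.

Definition oscillation p f r : \bar R :=
  ereal_sup [set Lp_norm p (euclid_ball x r) (fun y => f y - average r f x)
            | x in [set: 'rV[R]_n]].

Definition campanato_seminorm p q lambda f : \bar R :=
  Lq_dtt q `]0, +oo[%classic
    (fun r => ((r `^ (- lambda))%R%:E * oscillation p f r)%E).

Definition campanato_norm p q lambda f : \bar R :=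
  (campanato_seminorm p q lambda f +
   ereal_sup [set Lp_norm p (euclid_ball x 1) f | x in [set: 'rV[R]_n]])%E.

Definition modulus f t : \bar R :=
  ereal_sup [set Linf_norm (fun x => f (x + y) - f x)
            | y in [set y | euclid_norm y <= t]].

Definition besov_norm q alpha f : \bar R :=
  (Lq_dtt q `]0%R, 1%R[%classic
     (fun t => ((t `^ (- alpha))%R%:E * modulus f t)%E) + Linf_norm f)%E.

End spaces.

(* Main.v *)
Require Import Defs.
From mathcomp Require Import all_boot all_order all_algebra.
From mathcomp Require Import all_classical all_reals all_analysis.
From mathcomp Require Import measurable_realfun ess_sup_inf.
From mathcomp Require Import ring lra.

(* Dyadic form of the argument. Set r_k = 2^-k and let osc(r) be the supremum over
   balls of radius r of the L_p norm of f minus its average.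

   Besov controls Campanato: if |f(. + h) - f| <= w a.e. for every |h| <= 2r, Tonelli
   yields for each ball B of radius r a point z with |f - f(z)| <= w a.e. on B, so that
   osc(r) <= C r^(n/p) w.

   Campanato controls Besov: the averages of f over concentric or close balls of radii
   r_(k+1) and r_k differ by at most C r_k^(-n/p) osc(r_k). These bounds are summable,
   so by telescoping the averages at x + h and x, |h| <= r_(k+1), differ by at most
   C \sum_(i >= k) r_i^(-n/p) osc(r_i) at every finer scale. A set where
   |f(x + h) - f(x)| exceeds this by eta > 0 has, by Chebyshev, density tending to 0
   uniformly in all small balls, hence it is null. Hardy's inequality for dyadic
   sequences finishes.

   The functions of r under the integrals need not be shown measurable: they are
   compared with step functions that are constant on dyadic blocks. *)

Set Implicit Arguments.
Unset Strict Implicit.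
Unset Printing Implicit Defensive.

Import Order.TTheory GRing.Theory Num.Theory.
Import numFieldNormedType.Exports.

Local Open Scope classical_set_scope.
Local Open Scope ring_scope.

(** * Euclidean balls and Lebesgue measure on row vectors *)

(** Write b_k = r_k^(-lambda) osc(r_k) and theta = 2^(-alpha). Since lambda = alpha + n/p, the term
    r_k^(-n/p) osc(r_k) is theta^k b_k. Positivity of alpha thus makes the telescoping sums
    converge, and the tail from k, divided by theta^k, is the sum of theta^j b_(j+k) that Hardy's
    inequality controls.

    The oscillation subtracts the average over its own ball, so it is not visibly monotone in the
    radius. A comparison with factor 8 replaces monotonicity and allows values at dyadic radii to be
    read off from the integral.

    The two integrals have different ranges: (0, 1) for Besov, all r > 0 for Campanato. Radii r >=
    1/4 are paid for by the L_infty norm, the weight leaving the summable factor r^(-alpha); the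
    block [1/2, 1) of the Besov integral is treated likewise.

    For q < 1 there is no triangle inequality, so every combination of bounds goes through r-th
    powers and loses a factor 2^(1/q). The estimates are proved for real upper bounds of the parts
    of each norm; infinite norms are separated only at the end. *)

Section euclid_norm.
Context (R : realType) (n : nat).
Implicit Types x y z : 'rV[R]_n.

Lemma euclid_norm_ge0 x : 0 <= euclid_norm x.
Proof. exact: sqrtr_ge0. Qed.

Lemma euclid_norm_sqr x : euclid_norm x ^+ 2 = \sum_i x ord0 i ^+ 2.
Proof. by rewrite sqr_sqrtr// sumr_ge0// => i _; exact: sqr_ge0. Qed.

Lemma euclid_normN x : euclid_norm (- x) = euclid_norm x.
Proof.
by congr Num.sqrt; apply: eq_bigr => i _; rewrite mxE sqrrN.
Qed.

Lemma euclid_normB x y : euclid_norm (x - y) = euclid_norm (y - x).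
Proof. by rewrite -euclid_normN opprB. Qed.

Lemma euclid_norm0 : euclid_norm (0 : 'rV[R]_n) = 0.
Proof. by rewrite /euclid_norm big1 ?sqrtr0// => i _; rewrite mxE expr0n. Qed.

Lemma coord_le_euclid_norm x i : `|x ord0 i| <= euclid_norm x.
Proof.
rewrite -(ler_pXn2r (n := 2))// ?nnegrE ?euclid_norm_ge0//.
rewrite euclid_norm_sqr real_normK ?num_real// (bigD1 i)//= lerDl.
by rewrite sumr_ge0// => j _; exact: sqr_ge0.
Qed.

Lemma euclid_norm_eq0 x : euclid_norm x = 0 -> x = 0.
Proof.
move=> x0; apply/rowP => i; rewrite mxE; apply/eqP.
by rewrite -normr_le0 -x0; exact: coord_le_euclid_norm.
Qed.

(** Cauchy-Schwarz from Young's inequality with weights b/a and a/b, where a and b are the two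
    norms: each term falls short by (b x_i - a y_i)^2 / (2ab), and the weighted squares add up to
    exactly ab. Zero norms are set aside because of the divisions. *)
Lemma euclid_dot_le x y :
  \sum_i x ord0 i * y ord0 i <= euclid_norm x * euclid_norm y.
Proof.
have [x0|x0] := eqVneq (euclid_norm x) 0.
  by rewrite x0 mul0r big1// => i _; rewrite (euclid_norm_eq0 x0) mxE mul0r.
have [y0|y0] := eqVneq (euclid_norm y) 0.
  by rewrite y0 mulr0 big1// => i _; rewrite (euclid_norm_eq0 y0) mxE mulr0.
have a0 : 0 < euclid_norm x by rewrite lt0r x0 euclid_norm_ge0.
have b0 : 0 < euclid_norm y by rewrite lt0r y0 euclid_norm_ge0.
set a := euclid_norm x in x0 a0 *; set b := euclid_norm y in y0 b0 *.
rewrite (_ : a * b = \sum_i (b / a / 2 * x ord0 i ^+ 2 + a / b / 2 * y ord0 i ^+ 2)).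
  apply: ler_sum => i _; rewrite -subr_ge0.
  rewrite (_ : _ - _ =
    (b * x ord0 i - a * y ord0 i) ^+ 2 * (a * b * 2)^-1); last first.
    by field; rewrite x0 y0.
  by rewrite mulr_ge0 ?sqr_ge0// invr_ge0 !mulr_ge0// ltW.
rewrite big_split/= -!mulr_sumr -!euclid_norm_sqr -/a -/b.
by field; rewrite x0 y0.
Qed.

Lemma ler_euclid_normD x y :
  euclid_norm (x + y) <= euclid_norm x + euclid_norm y.
Proof.
rewrite -(ler_pXn2r (n := 2))// ?nnegrE ?addr_ge0 ?euclid_norm_ge0//.
rewrite euclid_norm_sqr sqrrD !euclid_norm_sqr.
under eq_bigr do rewrite mxE sqrrD.
rewrite !big_split/= lerD2r lerD2l.
by rewrite mulr2n lerD ?euclid_dot_le.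
Qed.

Lemma subset_euclid_ball x y r s :
  euclid_norm (x - y) + s <= r -> euclid_ball x s `<=` euclid_ball y r.
Proof.
move=> xyr z; rewrite /euclid_ball/= => zx.
rewrite (_ : z - y = (z - x) + (x - y)); last by rewrite addrA subrK.
by apply: le_lt_trans (ler_euclid_normD _ _) _; move: zx xyr; lra.
Qed.

Lemma euclid_ballC x y r : euclid_ball x r y -> euclid_ball y r x.
Proof. by rewrite /euclid_ball/= euclid_normB. Qed.

Lemma measurable_euclid_norm :
  measurable_fun [set: 'rV[R]_n] (@euclid_norm R n).
Proof.
apply: (measurableT_comp (continuous_measurable_fun (@sqrt_continuous R))) => //.
by apply: measurable_sum => i; apply: measurable_funX; exact: measurable_coord_rV.
Qed.

Lemma measurable_shift_rV y :
  measurable_fun [set: 'rV[R]_n] (fun x : 'rV[R]_n => x + y).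
Proof.
apply/measurable_fun_rVP => i; under eq_fun do rewrite mxE.
by apply: measurable_funD => //; exact: measurable_coord_rV.
Qed.

Lemma measurable_euclid_ball x r : measurable (euclid_ball x r).
Proof.
have := measurableT_comp measurable_euclid_norm (measurable_shift_rV (- x)).
move=> /(_ measurableT `]-oo, r[%classic (measurable_itv _)).
by rewrite setTI; congr measurable; apply/seteqP; split => z; rewrite /= in_itv.
Qed.

Lemma measurable_euclid_dist_lt r :
  measurable [set z : 'rV[R]_n * 'rV[R]_n | euclid_norm (z.2 - z.1) < r].
Proof.
pose g (z : 'rV[R]_n * 'rV[R]_n) : 'rV[R]_n := z.2 - z.1.
have m : measurable_fun setT g.
  apply/measurable_fun_rVP => i; rewrite /g; under eq_fun do rewrite !mxE.
  by apply: measurable_funB; apply: (measurableT_comp (@measurable_coord_rV R n i)).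
have := measurableT_comp measurable_euclid_norm m.
move=> /(_ measurableT `]-oo, r[%classic (measurable_itv _)).
by rewrite setTI; congr measurable; apply/seteqP; split => z; rewrite /= in_itv.
Qed.

End euclid_norm.

(** * Translation invariance of Lebesgue measure *)

Section lebesgue_rV_translation.
Context (R : realType).

Lemma lebesgue_measureD (a : R) (A : set (measurableTypeR R)) : measurable A ->
  pushforward lebesgue_measure
    ((fun x => x + a) : measurableTypeR R -> measurableTypeR R) A =
  lebesgue_measure A.
Proof.
move=> mA; apply/esym/lebesgue_measure_unique => //=.
  exact: measurable_funD.
move=> mD _ [[b c]] _ <-.
rewrite /pushforward (_ : _ @^-1` _ = `]b - a, c - a]%classic).
  rewrite !lebesgue_measure_itv/= !lte_fin ltrD2r; case: ifP => // _.
  by rewrite -!EFinB; congr EFin; ring.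
by apply/seteqP; split=> x /=; rewrite !in_itv/= ltrBlDr lerBrDr.
Qed.

(** Through [cons_rV] the translation acts separately on the first coordinate and on the rest, so it
    preserves the measure of rectangles; uniqueness of the product measure extends this to all
    measurable sets. *)
Lemma lebesgue_rVD n (y : 'rV[R]_n) (A : set 'rV[R]_n) : measurable A ->
  lebesgue_rV R n ((fun x => x + y) @^-1` A) = lebesgue_rV R n A.
Proof.
elim: n y A => [|n IH] y A mA.
  by congr (lebesgue_rV R 0 _); apply/seteqP; split=> x /=;
    rewrite !(thinmx0 (_ + _)) !(thinmx0 x).
pose y' := (uncons_rV y).2; pose a := y ord0 ord0.
pose g1 : measurableTypeR R -> measurableTypeR R := fun x => x + a.
pose g2 : 'rV[R]_n -> 'rV[R]_n := fun x => x + y'.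
pose g (z : measurableTypeR R * 'rV[R]_n) := (g1 z.1, g2 z.2).
have mg : measurable_fun setT g.
  apply/measurable_fun_pairP; split.
    by apply: (measurableT_comp (f := g1)) => //; exact: measurable_funD.
  by apply: (measurableT_comp (f := g2)) => //; exact: measurable_shift_rV.
have mB : measurable (@cons_rV R n @^-1` A).
  by rewrite -[X in measurable X]setTI; exact: measurable_cons_rV.
have gP X : measurable X -> pushforward (lebesgue_measure \x lebesgue_rV R n)%E g X =
    (lebesgue_measure \x lebesgue_rV R n)%E X.
  move=> mX; apply/esym/product_measure_unique => //=.
  move=> B C mB1 mC; rewrite /pushforward.
  rewrite (_ : g @^-1` (B `*` C) = (g1 @^-1` B) `*` (g2 @^-1` C)); last first.
    by apply/seteqP; split => -[].
  rewrite product_measure1E//.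
  - by congr (_ * _)%E; [exact: lebesgue_measureD|exact: IH].
  - by rewrite -[X in measurable X]setTI; exact: measurable_funD.
  - by rewrite -[X in measurable X]setTI; exact: measurable_shift_rV.
rewrite /= /lebesgue_rV_step /pushforward -[RHS]gP// /pushforward.
have consD z : cons_rV z + y = cons_rV (g z).
  apply/rowP => i; rewrite !mxE; case: unliftP => [j ->|->]//=; rewrite !mxE//.
by congr (_ _); apply/seteqP; split=> z /=; rewrite consD.
Qed.
End lebesgue_rV_translation.

(** * Volume of a ball between those of two cubes *)

Section ball_volume.
Context (R : realType) (n : nat).
Local Notation mu := (lebesgue_rV R n).
Implicit Types (x y z : 'rV[R]_n) (r : R).

Lemma measurable_box (a b : 'rV[R]_n) :
  measurable [set x : 'rV[R]_n | forall i, a ord0 i <= x ord0 i <= b ord0 i].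
Proof.
rewrite [X in measurable X](_ : _ = \bigcap_(i in [set: 'I_n])
    ((fun x : 'rV[R]_n => x ord0 i : R) @^-1` `[a ord0 i, b ord0 i])).
  apply: fin_bigcap_measurable => // i _.
  by rewrite -[X in measurable X]setTI; exact: measurable_coord_rV.
apply/seteqP; split => x /= h i; first by move=> _; rewrite /= in_itv /= h.
by have := h i I; rewrite /= in_itv.
Qed.

Lemma lebesgue_rV_cube x r : 0 <= r ->
  mu [set y | forall i, (x - const_mx r) ord0 i <= y ord0 i <=
                        (x + const_mx r) ord0 i] = ((2 * r) ^+ n)%:E.
Proof.
move=> r0; rewrite lebesgue_rV_box => [|i]; last by rewrite !mxE; lra.
congr EFin; transitivity (\prod_(i < n) (2 * r)).
  by apply: eq_bigr => i _; rewrite !mxE; ring.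
by rewrite prodr_const card_ord.
Qed.

Lemma lebesgue_rV_ball_le x r : 0 <= r ->
  (mu (euclid_ball x r) <= ((2 * r) ^+ n)%:E)%E.
Proof.
move=> r0; rewrite -(lebesgue_rV_cube x r0); apply: le_measure; rewrite ?inE.
- exact: measurable_euclid_ball.
- exact: measurable_box.
move=> y yx i; have /= := coord_le_euclid_norm (y - x) i.
move/le_lt_trans => /(_ _ yx); rewrite !mxE ltr_norml => /andP[]; lra.
Qed.

(* Volume of the cube of half-side [1 / (n + 1)], which lies in the unit ball. *)
Definition ball_ratio : R := (2 / n.+1%:R) ^+ n.

Lemma ball_ratio_gt0 : 0 < ball_ratio.
Proof. by rewrite exprn_gt0// divr_gt0. Qed.

Lemma lebesgue_rV_ball_ge x r : 0 < r ->
  ((ball_ratio * r ^+ n)%:E <= mu (euclid_ball x r))%E.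
Proof.
move=> r0.
have rn0 : 0 <= r / n.+1%:R by rewrite divr_ge0// ltW.
rewrite (_ : ball_ratio * _ = (2 * (r / n.+1%:R)) ^+ n); last first.
  by rewrite /ball_ratio -exprMn mulrA mulrAC.
rewrite -(lebesgue_rV_cube x rn0).
apply: le_measure; rewrite ?inE.
- exact: measurable_box.
- exact: measurable_euclid_ball.
move=> y /= yx; rewrite /euclid_ball/=.
rewrite -(ltr_pXn2r (n := 2))// ?nnegrE ?euclid_norm_ge0 ?(ltW r0)//.
rewrite euclid_norm_sqr.
(* The sum is n r^2 / (n + 1)^2. Dividing by n + 1 rather than n keeps it strictly below r^2 even
   for n <= 1. *)
apply: (@le_lt_trans _ _ (\sum_(i < n) (r / n.+1%:R) ^+ 2)).
  apply: ler_sum => i _; rewrite -(real_normK (num_real ((y - x) ord0 i))).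
  rewrite ler_pXn2r ?nnegrE//.
  have := yx i; rewrite !mxE ler_norml; move: (r / _) => t.
  by rewrite lerBlDr lerBrDr => /andP[? ?]; apply/andP; split; lra.
rewrite sumr_const card_ord -[ltLHS]mulr_natl expr_div_n mulrCA.
rewrite gtr_pMr ?exprn_gt0// ltr_pdivrMr ?exprn_gt0// mul1r.
by rewrite -natrX ltr_nat -mulnn leq_pmulr.
Qed.

Lemma fin_num_ball x r : 0 <= r -> mu (euclid_ball x r) \is a fin_num.
Proof.
move=> r0; rewrite ge0_fin_numE//.
exact: le_lt_trans (lebesgue_rV_ball_le x r0) (ltry _).
Qed.

End ball_volume.

(** * Null sets *)

Lemma measurable_gt_norm d (T : measurableType d) (R : realType) (g : T -> R)
    (eta : R) :
  measurable_fun setT g -> measurable [set x | (eta < `|g x|)%R].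
Proof.
move=> mg; have := measurable_fun_ltr (measurable_cst eta)
    (measurableT_comp (@normr_measurable R setT) mg) measurableT.
by move=> /(_ [set true]) => /(_ _); rewrite setTI; apply.
Qed.

Section almost_everywhere_rV.
Context (R : realType) (n : nat).
Local Notation mu := (lebesgue_rV R n).
Implicit Types (x y z : 'rV[R]_n) (r : R).

Lemma ae_shift_rV y (P : 'rV[R]_n -> Prop) :
  {ae mu, forall x, P x} -> {ae mu, forall x, P (x + y)}.
Proof.
move=> [N [mN N0 PN]]; exists ((fun x => x + y) @^-1` N); split.
- by rewrite -[X in measurable X]setTI; exact: measurable_shift_rV.
- by rewrite -N0; exact: lebesgue_rVD.
- by move=> x Px; exact: PN.
Qed.

Lemma bigcup_euclid_ball : \bigcup_k euclid_ball (0 : 'rV[R]_n) k%:R = setT.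
Proof.
rewrite -subTset => x _; exists (Num.truncn (euclid_norm x)).+1 => //.
by rewrite /euclid_ball/= subr0 truncnS_gt.
Qed.

(* Tonelli for [(x, z) : x \in N, |z - x| < r] replaces the covering of [N] by balls. *)
Lemma measure_le_local (N : set 'rV[R]_n) (K r e : R) :
  measurable N -> N `<=` euclid_ball 0 K -> 0 <= K -> 0 < r -> r <= 1 -> 0 <= e ->
  (forall z, (mu (N `&` euclid_ball z r) <= (e * r ^+ n)%:E)%E) ->
  (mu N <= (e * (2 * (K + 1)) ^+ n / ball_ratio R n)%:E)%E.
Proof.
move=> mN NK K0 r0 r1 e0 Ne.
pose S := [set z : 'rV[R]_n * 'rV[R]_n | euclid_norm (z.2 - z.1) < r] `&`
  (N `*` setT).
have mS : measurable S.
  by apply: measurableI; [exact: measurable_euclid_dist_lt|exact: measurableX].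
have xS x : N x -> xsection S x = euclid_ball x r.
  move=> Nx; apply/seteqP; split => z; rewrite /xsection/= inE.
    by move=> [].
  by move=> zx; split.
have yS z : ysection S z = N `&` euclid_ball z r.
  apply/seteqP; split => x; rewrite /ysection/= inE.
    by move=> [/= zx [Nx _]]; split => //; exact: euclid_ballC.
  by move=> [Nx xz]; split; [exact: euclid_ballC|].
(* Each x in [N] contributes a full ball of radius [r], which produces the factor [mu N]. *)
have lo : ((ball_ratio R n * r ^+ n)%:E * mu N <= \int[mu]_x mu (xsection S x))%E.
  rewrite -integral_cst//.
  apply: (@le_trans _ _ (\int[mu]_(x in N) mu (xsection S x))%E).
    apply: ge0_le_integral => //.
    - by move=> x _; rewrite lee_fin mulr_ge0 ?exprn_ge0 ?ltW ?ball_ratio_gt0.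
    - by apply: measurable_funTS; exact: measurable_fun_xsection.
    - by move=> x Nx; rewrite xS//=; exact: lebesgue_rV_ball_ge.
  by apply: ge0_subset_integral => //; exact: measurable_fun_xsection.
have up : (\int[mu]_z mu (ysection S z) <=
    (e * r ^+ n)%:E * ((2 * (K + 1)) ^+ n)%:E)%E.
  pose D : set 'rV[R]_n := euclid_ball 0 (K + 1).
  have mD : measurable D by exact: measurable_euclid_ball.
  (* A z with nonempty section lies within r <= 1 of [N], hence in the ball of radius [K + 1]. *)
  rewrite (_ : \int[mu]_z _ = \int[mu]_(z in D) mu (ysection S z))%E; last first.
    rewrite [RHS]integral_mkcond; apply: eq_integral => z _; rewrite patchE.
    case: ifPn => // /negP zD; rewrite (_ : ysection S z = set0) ?measure0//.
    rewrite yS -subset0 => x [Nx xz]; apply: zD; rewrite inE.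
    apply: (subset_euclid_ball _ (euclid_ballC xz)) => /=.
    by move: (NK _ Nx); rewrite /euclid_ball/=; lra.
  apply: (@le_trans _ _ (\int[mu]_(z in D) cst (e * r ^+ n)%:E z)%E).
    apply: ge0_le_integral => //.
    - by apply: measurable_funTS; exact: measurable_fun_ysection.
    - by move=> z _; rewrite yS.
  rewrite integral_cst//; apply: lee_wpmul2l.
    by rewrite lee_fin mulr_ge0// exprn_ge0// ltW.
  by apply: lebesgue_rV_ball_le; lra.
have := indic_fubini_tonelli mu mu mS.
rewrite indic_fubini_tonelli_FE// indic_fubini_tonelli_GE//= => FT.
have rn0 : 0 < r ^+ n by rewrite exprn_gt0.
have v0 := ball_ratio_gt0 R n.
have := le_trans lo (eq_ind_r (fun t => t <= _)%E up FT).
have [m|] := boolP (mu N \is a fin_num); last first.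
  rewrite ge0_fin_numE// -leNgt leye_eq => /eqP ->.
  by rewrite gt0_muley// lte_fin mulr_gt0.
rewrite -(fineK m) -!EFinM !lee_fin => h.
rewrite ler_pdivlMr// -(ler_pM2r rn0); apply: le_trans (le_trans h _).
  by rewrite le_eqVlt; apply/orP; left; apply/eqP; ring.
by rewrite le_eqVlt; apply/orP; left; apply/eqP; ring.
Qed.

(* A substitute for Lebesgue's differentiation theorem. *)
Lemma ae_le_local (F : 'rV[R]_n -> R) (M : R) :
  measurable_fun setT F ->
  (forall eta e : R, 0 < eta -> 0 < e -> exists r : R, [/\ 0 < r, r <= 1 &
    forall z, (mu ([set x | (M + eta < `|F x|)%R] `&` euclid_ball z r) <=
      (e * r ^+ n)%:E)%E]) ->
  {ae mu, forall x, `|F x| <= M}.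
Proof.
move=> mF H.
pose N k : set 'rV[R]_n := [set x | M + k.+1%:R^-1 < `|F x|].
have mN k : measurable (N k) by exact: measurable_gt_norm.
have N0 k j : mu (N k `&` euclid_ball 0 j%:R) = 0.
  have mNj : measurable (N k `&` euclid_ball 0 j%:R).
    by apply: measurableI => //; exact: measurable_euclid_ball.
  apply/eqP; rewrite -measure_le0; apply/lee_addgt0Pr => e e0; rewrite add0e.
  (* [c] is the constant of [measure_le_local] for the ball of radius j, so that density [e / c]
     forces measure at most [e]. *)
  pose c := (2 * (j%:R + 1)) ^+ n / ball_ratio R n.
  have c0 : 0 < c.
    by rewrite divr_gt0 ?ball_ratio_gt0 ?exprn_gt0// mulr_gt0// ltr_wpDl.
  have k0 : 0 < k.+1%:R^-1 :> R by rewrite invr_gt0.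
  have [r [r0 r1 Hr]] := H _ _ k0 (divr_gt0 e0 c0).
  have := @measure_le_local (N k `&` euclid_ball 0 j%:R) j%:R r (e / c) mNj.
  move=> /(_ (@subIsetr _ _ _) (ler0n _ _) r0 r1 (ltW (divr_gt0 e0 c0))).
  rewrite -mulrA -/c divfK ?gt_eqF// => h; apply: h => z.
  apply: le_trans (Hr z); apply: le_measure; rewrite ?inE.
  - by apply: measurableI => //; exact: measurable_euclid_ball.
  - by apply: measurableI; [exact: (mN k)|exact: measurable_euclid_ball].
  - by apply: setSI; exact: subIsetl.
have : mu.-negligible (\bigcup_k \bigcup_j (N k `&` euclid_ball 0 j%:R)).
  apply: negligible_bigcup => k; apply: negligible_bigcup => j.
  apply/negligibleP; last exact: N0.
  by apply: measurableI => //; exact: measurable_euclid_ball.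
apply: negligibleS => x /= /negP; rewrite -ltNge => Mx.
have d0 : 0 < `|F x| - M by rewrite subr_gt0.
exists (Num.truncn (`|F x| - M)^-1) => //.
have [j _ xj] : (\bigcup_k euclid_ball (0 : 'rV[R]_n) k%:R) x.
  by rewrite bigcup_euclid_ball.
exists j => //; split => //; rewrite /N/= -ltrBrDl.
by rewrite invf_plt ?posrE// truncnS_gt.
Qed.

End almost_everywhere_rV.

(** * Averages and oscillation *)

Section Lp_average.
Context d (T : measurableType d) (R : realType).
Variable m : {measure set T -> \bar R}.
Implicit Types (E : set T) (f : T -> R) (p c D v : R).

(** Stands in for Hölder's inequality: when t > s, the ratio t/s exceeds 1 and is therefore at most
    its p-th power. Integrated over a set of finite measure, this bounds an L_1 norm by an L_p
    norm. *)
Lemma le_add_powR (p t s : R) : 1 <= p -> 0 <= t -> 0 < s ->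
  t <= s + s * (t / s) `^ p.
Proof.
move=> p1 t0 s0; have [ts|st] := leP t s.
  by rewrite (le_trans ts)// lerDl mulr_ge0 ?powR_ge0// ltW.
apply: (@le_trans _ _ (s * (t / s) `^ p)); last by rewrite lerDr ltW.
have ts1 : 1 <= t / s by rewrite ler_pdivlMr// mul1r ltW.
rewrite -ler_pdivrMl// mulrC; exact: le1r_powR.
Qed.

Lemma powRD_le (p a b : R) : 0 <= p -> 0 <= a -> 0 <= b ->
  (a + b) `^ p <= 2 `^ p * (a `^ p + b `^ p).
Proof.
move=> p0; wlog ab : a b / a <= b.
  move=> H a0 b0; have [ab|/ltW ba] := leP a b; first exact: H.
  by rewrite addrC (addrC (a `^ p)); apply: H.
move=> a0 b0; apply: (@le_trans _ _ ((2 * b) `^ p)).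
  by apply: ge0_ler_powR; rewrite ?nnegrE ?addr_ge0 ?mulr_ge0//; lra.
by rewrite powRM// ler_wpM2l ?powR_ge0// lerDr powR_ge0.
Qed.

Lemma measurable_powR_norm E f p : measurable_fun E f ->
  measurable_fun E (fun x => (`|f x| `^ p)%:E).
Proof.
move=> mf; apply/measurable_EFinP.
apply: (measurableT_comp (measurable_powR _)).
exact: measurableT_comp.
Qed.

(** Integrate [le_add_powR] with [s := D]: the constant term and the power term contribute [D * v]
    each. *)
Lemma integral_norm_le E f p D v : measurable E -> measurable_fun E f ->
  1 <= p -> 0 < D -> 0 <= v -> m E = v%:E ->
  (\int[m]_(x in E) (`|f x| `^ p)%:E <= (D `^ p * v)%:E)%E ->
  (\int[m]_(x in E) `|f x|%:E <= (2 * D * v)%:E)%E.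
Proof.
move=> mE mf p1 D0 v0 mEv fD.
have mfp := measurable_powR_norm p mf.
pose k := D * D^-1 `^ p.
have k0 : 0 <= k by rewrite mulr_ge0 ?powR_ge0// ltW.
apply: (@le_trans _ _
    (\int[m]_(x in E) (D%:E + k%:E * (`|f x| `^ p)%:E))%E).
  apply: ge0_le_integral => //.
  - by apply/measurable_EFinP; exact: measurableT_comp.
  - by apply: emeasurable_funD => //; exact: emeasurable_funM.
  - move=> x _; rewrite -EFinM -EFinD lee_fin.
    apply: (le_trans (le_add_powR p1 (normr_ge0 _) D0)).
    rewrite powRM ?invr_ge0 ?(ltW D0)// /k lerD2l.
    by rewrite [leLHS](_ : _ = k * `|f x| `^ p)//; rewrite /k; ring.
rewrite ge0_integralD//; last 3 first.
- by move=> x _; rewrite lee_fin ltW.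
- by move=> x _; rewrite -EFinM lee_fin mulr_ge0 ?powR_ge0.
- exact: emeasurable_funM.
rewrite integral_cst// mEv ge0_integralZl_EFin//.
apply: (@le_trans _ _ (D%:E * v%:E + k%:E * (D `^ p * v)%:E)%E).
  by rewrite leeD2l// lee_wpmul2l// lee_fin.
rewrite -!EFinM -EFinD lee_fin /k.
have -> : D * D^-1 `^ p * (D `^ p * v) = D * (D^-1 * D) `^ p * v.
  by rewrite powRM ?invr_ge0 ?(ltW D0)//; ring.
by rewrite mulVf ?gt_eqF// powR1 mulr1 -mulrA mulr_natl mulr2n.
Qed.

(** Integrability is part of the argument: the bound makes [f - c] integrable on [E], and constants
    are integrable because [m E] is finite. Only then does the real-valued integral of [f] split. *)
Lemma average_dist_le E f p c D v : measurable E -> measurable_fun E f ->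
  1 <= p -> 0 < D -> 0 < v -> m E = v%:E ->
  (\int[m]_(x in E) (`|f x - c| `^ p)%:E <= (D `^ p * v)%:E)%E ->
  `|v^-1 * \int[m]_(x in E) f x - c| <= 2 * D.
Proof.
move=> mE mf p1 D0 v0 mEv fD.
have mfc : measurable_fun E (fun x => f x - c) by exact: measurable_funB.
have ic : m.-integrable E (EFin \o cst c).
  apply/integrableP; split; first exact/measurable_EFinP.
  by under eq_integral do rewrite /=; rewrite integral_cst// mEv -EFinM ltry.
have ifc : m.-integrable E (EFin \o (fun x => f x - c)).
  apply/integrableP; split; first exact/measurable_EFinP.
  apply: le_lt_trans (ltry (2 * D * v)).
  exact: (integral_norm_le mE mfc p1 D0 (ltW v0) mEv fD).
have -> : \int[m]_(x in E) f x = \int[m]_(x in E) (f x - c) + c * v.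
  under eq_Rintegral do rewrite -[f _](subrK c).
  by rewrite [LHS]RintegralD// (Rintegral_cst m mE c) mEv.
rewrite mulrDr mulrCA mulVf ?gt_eqF// mulr1 addrK normrM [`|v^-1|]gtr0_norm ?invr_gt0//.
rewrite ler_pdivrMl// mulrC; apply: (le_trans (le_normr_Rintegral _ _)) => //.
rewrite -lee_fin fineK.
  exact: (integral_norm_le mE mfc p1 D0 (ltW v0) mEv fD).
exact: integrable_fin_num (integrable_norm ifc).
Qed.

End Lp_average.

Lemma powRV (R : realType) (a x : R) : 0 <= a -> a^-1 `^ x = (a `^ x)^-1.
Proof. by move=> a0; rewrite -!powR_inv1 ?powR_ge0// powRAC. Qed.

Lemma poweR_inv_leP (R : realType) (J : \bar R) (p o : R) :
  0 < p -> (0 <= J)%E -> 0 <= o -> (J `^ p^-1 <= o%:E)%E <-> (J <= (o `^ p)%:E)%E.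
Proof.
move=> p0 J0 o0; split => h.
  rewrite -[J](@poweRe1 R)// -(mulVf (lt0r_neq0 p0)) poweRrM -poweR_EFin.
  apply: gt0_ler_poweR => //; first exact: ltW.
  - by rewrite in_itv/= poweR_ge0 leey.
  - by rewrite in_itv/= lee_fin o0 leey.
rewrite -[leRHS](congr1 EFin (powRr1 o0)) -(mulfV (lt0r_neq0 p0)) powRrM -poweR_EFin.
apply: gt0_ler_poweR => //; first by rewrite invr_ge0 ltW.
- by rewrite in_itv/= J0 leey.
- by rewrite in_itv/= lee_fin powR_ge0 leey.
Qed.

Section Lp_norm_level.
Context (R : realType) (n : nat).
Local Notation mu := (lebesgue_rV R n).
Implicit Types (E : set 'rV[R]_n) (f : 'rV[R]_n -> R) (p o eta r : R).

Lemma Lp_norm_leP p E f o : 0 < p -> 0 <= o ->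
  (Lp_norm p E f <= o%:E)%E <->
  (\int[mu]_(y in E) (`|f y| `^ p)%:E <= (o `^ p)%:E)%E.
Proof.
move=> p0 o0; apply: poweR_inv_leP => //.
by apply: integral_ge0 => y _; rewrite lee_fin powR_ge0.
Qed.

Lemma oscillation_leP p f r o : 0 < p -> 0 <= o ->
  (oscillation p f r <= o%:E)%E <->
  forall x, (\int[mu]_(y in euclid_ball x r)
    (`|f y - average r f x| `^ p)%:E <= (o `^ p)%:E)%E.
Proof.
move=> p0 o0; split => [h x|h].
  apply/(Lp_norm_leP (euclid_ball x r) (fun y => f y - average r f x) p0 o0).
  by apply: le_trans h; apply: ereal_sup_ubound; exists x.
by apply: ge_ereal_sup => _ [x _ <-]; apply/Lp_norm_leP => //; exact: h.
Qed.

Lemma Lp_chebyshev p E f o eta : 0 < p -> 0 < eta -> measurable E ->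
  measurable_fun setT f ->
  (\int[mu]_(y in E) (`|f y| `^ p)%:E <= (o `^ p)%:E)%E -> 0 <= o ->
  (mu (E `&` [set x | (eta < `|f x|)%R]) <= ((o / eta) `^ p)%:E)%E.
Proof.
move=> p0 eta0 mE mf h o0; set N := E `&` _.
have mN : measurable N by apply: measurableI => //; exact: measurable_gt_norm.
have mfp := measurable_powR_norm p mf.
have : ((eta `^ p)%:E * mu N <= (o `^ p)%:E)%E.
  apply: le_trans h; rewrite -integral_cst//.
  apply: (@le_trans _ _ (\int[mu]_(y in N) (`|f y| `^ p)%:E)%E).
    apply: ge0_le_integral => //.
    - by move=> x _; rewrite lee_fin powR_ge0.
    - exact: measurable_funTS.
    - move=> x [_ /= /ltW fx]; rewrite lee_fin.
      by apply: ge0_ler_powR; rewrite ?nnegrE// ltW.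
  apply: ge0_subset_integral => //; last exact: subIsetl.
  exact: measurable_funTS.
rewrite muleC -lee_pdivlMr ?powR_gt0// => /le_trans; apply.
by rewrite lee_fin powRM ?invr_ge0 ?(ltW eta0)// powRV ?(ltW eta0).
Qed.

End Lp_norm_level.

Section averages.
Context (R : realType) (n : nat) (p : R) (f : 'rV[R]_n -> R).
Hypotheses (p1 : 1 <= p) (mf : measurable_fun setT f).
Local Notation mu := (lebesgue_rV R n).
Implicit Types (x y z : 'rV[R]_n) (r s o eta : R).

Let p0 : 0 < p. Proof. exact: lt_le_trans p1. Qed.

(** A lower bound, independent of the center, for the p-th root of the volume of a ball of radius
    [s]; it spares the exact volume. *)
Definition ball_root s : R := (ball_ratio R n * s ^+ n) `^ p^-1.

Lemma ball_root_gt0 s : 0 < s -> 0 < ball_root s.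
Proof. by move=> s0; rewrite powR_gt0// mulr_gt0 ?ball_ratio_gt0// exprn_gt0. Qed.

Lemma fine_ball_gt0 x s : 0 < s -> 0 < fine (mu (euclid_ball x s)).
Proof.
move=> s0; rewrite -lte_fin fineK ?fin_num_ball ?(ltW s0)//.
apply: lt_le_trans (lebesgue_rV_ball_ge x s0).
by rewrite lte_fin mulr_gt0 ?ball_ratio_gt0// exprn_gt0.
Qed.

Lemma ball_root_le x s : 0 < s ->
  ball_root s <= fine (mu (euclid_ball x s)) `^ p^-1.
Proof.
move=> s0; apply: ge0_ler_powR; rewrite ?nnegrE ?invr_ge0 ?(ltW p0)//.
- by rewrite mulr_ge0 ?exprn_ge0// ltW// ball_ratio_gt0.
- exact/ltW/fine_ball_gt0.
by rewrite -lee_fin fineK ?fin_num_ball ?(ltW s0)//; exact: lebesgue_rV_ball_ge.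
Qed.

Lemma average_sub_ball x z r s o c : 0 < s -> 0 < o ->
  euclid_ball z s `<=` euclid_ball x r ->
  (\int[mu]_(y in euclid_ball x r) (`|f y - c| `^ p)%:E <= (o `^ p)%:E)%E ->
  `|average s f z - c| <= 2 * (o / fine (mu (euclid_ball z s)) `^ p^-1).
Proof.
move=> s0 o0 zx h; set v := fine _.
have v0 : 0 < v by exact: fine_ball_gt0.
have mE : forall x r, measurable (euclid_ball x r) by exact: measurable_euclid_ball.
have mg : measurable_fun setT (fun y => (`|f y - c| `^ p)%:E).
  apply: (@measurable_powR_norm _ _ _ setT (fun y => f y - c)).
  exact: measurable_funB.
(* Here D = o / v^(1/p), chosen so that D^p v = o^p. *)
apply: (@average_dist_le _ _ _ _ _ f p) => //.
- exact: measurable_funTS.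
- by rewrite divr_gt0// powR_gt0.
- by rewrite fineK ?fin_num_ball ?(ltW s0).
rewrite powRM ?invr_ge0 ?powR_ge0 ?(ltW o0)// powRV ?powR_ge0//.
rewrite -powRrM mulVf ?lt0r_neq0// powRr1 ?(ltW v0)// divfK ?lt0r_neq0//.
apply: le_trans h; apply: ge0_subset_integral => //.
exact: measurable_funTS.
Qed.

Lemma average_dist x z r s o : 0 < s -> 0 <= o ->
  euclid_norm (z - x) + s <= r -> (oscillation p f r <= o%:E)%E ->
  `|average s f z - average r f x| <= 2 * (o / ball_root s).
Proof.
move=> s0 + zx; have b0 := ball_root_gt0 s0.
(* [average_sub_ball] wants a positive bound; [o = 0] is reached by enlarging [o] just enough to
   change the conclusion by [e]. *)
wlog o0 : o / 0 < o => [H o0 h|_].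
  apply/ler_addgt0Pr => e e0.
  have oe : 0 < o + e * (ball_root s / 2).
    by rewrite ltr_wpDl// mulr_gt0// divr_gt0.
  have -> : 2 * (o / ball_root s) + e =
      2 * ((o + e * (ball_root s / 2)) / ball_root s) by field; rewrite gt_eqF.
  apply: H => //; first exact: ltW.
  by apply: (le_trans h); rewrite lee_fin lerDl mulr_ge0 ?divr_ge0 ?ltW.
move=> /(oscillation_leP f r p0 (ltW o0)) h.
apply: (le_trans (average_sub_ball s0 o0 (subset_euclid_ball zx) (h x))).
rewrite ler_pM2l// ler_pM2l// lef_pV2 ?posrE ?ball_root_gt0 ?powR_gt0//.
  exact: ball_root_le.
exact: fine_ball_gt0.
Qed.

(** Passing to the smaller ball also changes the subtracted average, by at most 2o / v^(1/p) with v
    the volume of the smaller ball. The 8 is a product of three factors 2: one from [powRD_le], one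
    from this shift, one from o^p + (2o)^p <= 2^p (2o)^p. *)
Lemma oscillation_mono s r o : 0 < s -> s <= r -> 0 <= o ->
  (oscillation p f r <= o%:E)%E -> (oscillation p f s <= (8 * o)%:E)%E.
Proof.
move=> s0 sr; wlog o0 : o / 0 < o => [H o0 h|_].
  apply/lee_addgt0Pr => e e0; have oe : 0 < o + e / 8 by rewrite ltr_wpDl// divr_gt0.
  rewrite -EFinD (_ : 8 * o + e = 8 * (o + e / 8)); last by field.
  apply: H => //; first exact: ltW.
  by apply: (le_trans h); rewrite lee_fin lerDl divr_ge0 ?ltW.
move=> /(oscillation_leP f r p0 (ltW o0)) h.
apply/oscillation_leP => //; first by rewrite mulr_ge0// ltW.
move=> x; set c := average r f x; set a := average s f x.
set v := fine (mu (euclid_ball x s)).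
have v0 : 0 < v by exact: fine_ball_gt0.
have mE : forall x r, measurable (euclid_ball x r) by exact: measurable_euclid_ball.
have mg c' E : measurable_fun E (fun y => (`|f y - c'| `^ p)%:E).
  apply: measurable_funTS.
  apply: (@measurable_powR_norm _ _ _ setT (fun y => f y - c')).
  exact: measurable_funB.
have sub : euclid_ball x s `<=` euclid_ball x r.
  by apply: subset_euclid_ball; rewrite subrr euclid_norm0 add0r.
have ac : `|c - a| <= 2 * (o / v `^ p^-1).
  by rewrite distrC; exact: average_sub_ball (h x).
have acp : `|c - a| `^ p * v <= (2 * o) `^ p.
  apply: (@le_trans _ _ ((2 * (o / v `^ p^-1)) `^ p * v)).
    rewrite ler_wpM2r ?(ltW v0)//; apply: ge0_ler_powR; rewrite ?nnegrE ?(ltW p0)//.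
    by rewrite mulr_ge0// divr_ge0 ?powR_ge0 ?ltW.
  rewrite mulrA powRM ?invr_ge0 ?powR_ge0 ?mulr_ge0 ?(ltW o0)// powRV ?powR_ge0//.
  by rewrite -powRrM mulVf ?lt0r_neq0// powRr1 ?(ltW v0)// divfK ?lt0r_neq0.
apply: (@le_trans _ _ (\int[mu]_(y in euclid_ball x s)
    ((2 `^ p)%:E * ((`|f y - c| `^ p)%:E + (`|c - a| `^ p)%:E)))%E).
  apply: ge0_le_integral => //.
  - by apply: emeasurable_funM => //; exact: emeasurable_funD.
  move=> y _; rewrite -EFinD -EFinM lee_fin.
  apply: le_trans (powRD_le (ltW p0) (normr_ge0 _) (normr_ge0 _)).
  apply: ge0_ler_powR; rewrite ?nnegrE ?addr_ge0 ?(ltW p0)//.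
  by apply: le_trans (ler_normD _ _); rewrite addrA subrK.
rewrite ge0_integralZl_EFin ?powR_ge0//; last first.
- exact: emeasurable_funD.
- by move=> y _; rewrite -EFinD lee_fin addr_ge0 ?powR_ge0.
rewrite ge0_integralD//; try by move=> *; rewrite lee_fin powR_ge0.
rewrite [X in (_ + X)%E](_ : _ = (`|c - a| `^ p * v)%:E); last first.
  by rewrite integral_cst// EFinM /v fineK ?fin_num_ball ?(ltW s0).
apply: (@le_trans _ _ ((2 `^ p)%:E * ((o `^ p)%:E + ((2 * o) `^ p)%:E))%E).
  rewrite lee_wpmul2l ?lee_fin ?powR_ge0//; apply: leeD; last by rewrite lee_fin.
  apply: le_trans (h x); exact: ge0_subset_integral.
rewrite -EFinD -EFinM lee_fin.
apply: (@le_trans _ _ (2 `^ p * (2 `^ p * (2 * o) `^ p))).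
  rewrite ler_wpM2l ?powR_ge0//.
  have oo : o `^ p <= (2 * o) `^ p.
    apply: ge0_ler_powR; rewrite ?nnegrE ?(ltW p0) ?mulr_ge0 ?(ltW o0)//.
    by rewrite ler_peMl ?(ltW o0)// ler1n.
  apply: (@le_trans _ _ (2 * (2 * o) `^ p)); first by move: oo; lra.
  by rewrite ler_wpM2r ?powR_ge0//; apply: le1r_powR => //; lra.
rewrite -!powRM// ?mulr_ge0 ?(ltW o0)//.
by rewrite (_ : 2 * (2 * (2 * o)) = 8 * o)//; ring.
Qed.

Lemma chebyshev_average z r o eta : 0 < eta -> 0 <= o ->
  (oscillation p f r <= o%:E)%E ->
  (mu (euclid_ball z r `&` [set x | (eta < `|f x - average r f z|)%R]) <=
    ((o / eta) `^ p)%:E)%E.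
Proof.
move=> eta0 o0 /(oscillation_leP f r p0 o0) h.
apply: (@Lp_chebyshev _ _ _ _ (fun x => f x - average r f z)) => //.
- exact: measurable_euclid_ball.
- exact: measurable_funB.
Qed.

End averages.

(** * Telescoping of dyadic averages *)

(** Otherwise more than M/e terms, each at least [e], would push a partial sum above [M]. *)
Lemma bounded_sum_small (R : realType) (d : nat -> R) (k : nat) (M e : R) :
  (forall m, \sum_(k <= i < m) d i <= M) -> 0 < e ->
  exists2 m, (k <= m)%N & d m < e.
Proof.
move=> dM e0; apply: contrapT => H.
have de i : (k <= i)%N -> e <= d i.
  by move=> ki; rewrite leNgt; apply/negP => die; apply: H; exists i.
pose N := (Num.truncn (M / e)).+1.
have := dM (k + N)%N; apply/negP; rewrite -ltNge.
apply: (@lt_le_trans _ _ (\sum_(k <= i < k + N) e)); last first.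
  by apply: ler_sum_nat => i /andP[ki _]; exact: de.
by rewrite sumr_const_nat addKn -mulr_natr mulrC -ltr_pdivrMr// truncnS_gt.
Qed.

Lemma ler_dist3 (R : realType) (a b c d u v w : R) :
  `|a - b| <= u -> `|b - c| <= v -> `|d - c| <= w -> `|a - d| <= u + v + w.
Proof.
move=> ab bc dc; rewrite (_ : a - d = (a - b) + (b - c) + (c - d)); last by ring.
apply: (le_trans (ler_normD _ _)); apply: lerD; last by rewrite distrC.
exact: (le_trans (ler_normD _ _) (lerD ab bc)).
Qed.

Section dyad.
Context (R : realType).

Definition dyad (k : nat) : R := 2^-1 ^+ k.

Lemma dyad_gt0 k : 0 < dyad k. Proof. by rewrite exprn_gt0. Qed.

Lemma dyadS k : 2 * dyad k.+1 = dyad k.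
Proof. by rewrite /dyad exprS mulrA mulfV ?mul1r ?gt_eqF. Qed.

Lemma dyad_le1 k : dyad k <= 1.
Proof. by rewrite exprn_ile1// invf_le1// ler1n. Qed.

End dyad.

Section telescoping.
Context (R : realType) (n : nat) (p : R) (f : 'rV[R]_n -> R).
Hypotheses (p1 : 1 <= p) (mf : measurable_fun setT f).
Local Notation mu := (lebesgue_rV R n).
Implicit Types (x y z h : 'rV[R]_n) (eta e M : R).

Let p0 : 0 < p. Proof. exact: lt_le_trans p1. Qed.

Variable o : nat -> R.
Hypothesis o0 : forall k, 0 <= o k.
Hypothesis osc_o : forall k, (oscillation p f (dyad R k) <= (o k)%:E)%E.

(** The bound of [average_dist] for passing from scale k to scale k + 1; the root is taken at the
    smaller radius, whose ball is the one averaged over. *)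
Definition jump k : R := 2 * (o k / ball_root n p (dyad R k.+1)).

Lemma jump_ge0 k : 0 <= jump k.
Proof. by rewrite mulr_ge0// divr_ge0// ltW// ball_root_gt0// dyad_gt0. Qed.

Lemma average_step x h k : euclid_norm h <= dyad R k.+1 ->
  `|average (dyad R k.+1) f (x + h) - average (dyad R k) f x| <= jump k.
Proof.
move=> hk; apply: average_dist => //; first exact: dyad_gt0.
(* The two radii leave exactly the room for h: 2 r_(k+1) = r_k. *)
by rewrite addrAC subrr add0r; have := dyadS R k; move: hk; lra.
Qed.

Lemma average_telescope x k m : (k <= m)%N ->
  `|average (dyad R m) f x - average (dyad R k) f x| <= \sum_(k <= i < m) jump i.
Proof.
move=> /subnKC <-; elim: (m - k)%N => [|j IH].
  by rewrite addn0 subrr normr0 big_geq.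
rewrite addnS big_nat_recr ?leq_addr//= addrC.
set a := average (dyad R (k + j)) f x in IH *.
rewrite (_ : _ - _ = (average (dyad R (k + j).+1) f x - a) +
    (a - average (dyad R k) f x)).
  apply: le_trans (ler_normD _ _) (lerD _ IH).
  by rewrite -{1}(addr0 x); apply: average_step; rewrite euclid_norm0 ltW// dyad_gt0.
by rewrite addrA subrK.
Qed.

(** The path from one average to the other climbs at z + h from scale m to k + 1, crosses to scale k
    at z, steps back to k + 1 at z and descends to m. The two crossings cost a [jump k] each, the
    climb and the descent a tail each. *)
Lemma average_shift z h k m : (k < m)%N -> euclid_norm h <= dyad R k.+1 ->
  `|average (dyad R m) f (z + h) - average (dyad R m) f z| <=
  2 * \sum_(k <= i < m) jump i.
Proof.
move=> km hk; rewrite big_ltn//.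
have := average_telescope (z + h) km; have := average_telescope z km.
have := average_step z hk; have := @average_step z 0 k.
rewrite euclid_norm0 addr0 => /(_ (ltW (dyad_gt0 R _))).
set a := average (dyad R m) f (z + h); set b := average (dyad R m) f z.
set c := average (dyad R k.+1) f z; set c' := average (dyad R k.+1) f (z + h).
set d := average (dyad R k) f z; set s := \sum_(_ <= _ < _) _ => cd c'd bc ac'.
have cc : `|c' - c| <= jump k + jump k.
  by apply: le_trans (ler_distD d c' c) (lerD c'd _); rewrite distrC; exact: cd.
apply: (le_trans (ler_dist3 ac' cc bc)).
by move: (jump k) s {bc ac' cd c'd cc} => u v; lra.
Qed.

(** Bounded sums force some [jump m] to be small, and [m] does not depend on z. Chebyshev's bound
    (o_m / eta)^p is (jump_m / (2 eta))^p times a multiple of r_(m+1)^n, hence small relative to the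
    volume of the ball. *)
Lemma chebyshev_small k M eta e : (forall m, \sum_(k <= i < m) jump i <= M) ->
  0 < eta -> 0 < e -> exists2 m, (k <= m)%N & forall z,
  (mu (euclid_ball z (dyad R m) `&`
    [set x | (eta < `|f x - average (dyad R m) f z|)%R]) <= (e * dyad R m ^+ n)%:E)%E.
Proof.
move=> sM eta0 e0.
(* The minimum with 1 gives c^p <= c; the other entry makes c times [ball_ratio] at most [e]. *)
pose c := Num.min 1 (e / ball_ratio R n).
have c0 : 0 < c by rewrite lt_min ltr01/= divr_gt0// ball_ratio_gt0.
have [m km jm] := bounded_sum_small sM (mulr_gt0 c0 (mulr_gt0 (ltr0n _ 2) eta0)).
exists m => // z; apply: (le_trans (chebyshev_average p1 mf z eta0 (o0 m) (osc_o m))).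
rewrite lee_fin.
have b0 := @ball_root_gt0 _ n p _ (dyad_gt0 R m.+1).
have -> : o m / eta = (jump m / (2 * eta)) * ball_root n p (dyad R m.+1).
  by rewrite /jump; field; rewrite !gt_eqF.
have j0 : 0 <= jump m / (2 * eta).
  by rewrite divr_ge0 ?jump_ge0// mulr_ge0 ?ltW.
have jc : jump m / (2 * eta) <= c by rewrite ler_pdivrMr ?mulr_gt0// ltW.
rewrite powRM ?(ltW b0)// /ball_root -powRrM mulVf ?lt0r_neq0//.
rewrite powRr1; last by rewrite mulr_ge0 ?exprn_ge0 ?ltW ?ball_ratio_gt0.
apply: (@le_trans _ _ (c * (ball_ratio R n * dyad R m.+1 ^+ n))).
  rewrite ler_wpM2r//.
    by rewrite mulr_ge0 ?exprn_ge0 ?ltW ?ball_ratio_gt0.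
  apply: (@le_trans _ _ (c `^ p)).
    by apply: ge0_ler_powR; rewrite ?nnegrE ?(ltW p0) ?(ltW c0).
  by apply: ge1r_powR => //; rewrite c0 ge_min lexx.
rewrite mulrA; apply: ler_pM.
- by rewrite mulr_ge0 ?ltW ?ball_ratio_gt0.
- by rewrite exprn_ge0// ltW// dyad_gt0.
- by rewrite -ler_pdivlMr ?ball_ratio_gt0// ge_min lexx orbT.
apply: lerXn2r; rewrite ?nnegrE ?(ltW (dyad_gt0 R _))//.
by have := dyad_gt0 R m.+1; have := dyadS R m; lra.
Qed.

(** If f(x) and f(x + h) are each within eta/2 of the averages around z and z + h, they differ by at
    most M + eta, as those averages differ by at most [M]. The bad points thus lie in two sets of
    small density. *)
Lemma ae_shift_le h k M : euclid_norm h <= dyad R k.+1 ->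
  (forall m, 2 * \sum_(k <= i < m) jump i <= M) ->
  {ae mu, forall x, `|f (x + h) - f x| <= M}.
Proof.
move=> hk sM; apply: ae_le_local.
  by apply: measurable_funB => //; exact: (measurableT_comp mf (measurable_shift_rV h)).
move=> eta e eta0 e0.
(* Starting at [k.+1] ensures that the scale found below satisfies [k < m], as [average_shift]
   requires. *)
have sM' m : \sum_(k.+1 <= i < m) jump i <= M / 2.
  rewrite ler_pdivlMr// mulrC; apply: le_trans (sM m); rewrite ler_pM2l//.
  have [km|mk] := ltnP k m; first by rewrite [leRHS]big_ltn// lerDr jump_ge0.
  by rewrite big_geq ?sumr_ge0 ?(leq_trans mk)// => i _; exact: jump_ge0.
have eta2 : 0 < eta / 2 by rewrite divr_gt0.
have e2 : 0 < e / 2 by rewrite divr_gt0.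
have [m km Hm] := chebyshev_small sM' eta2 e2.
exists (dyad R m); split; [exact: dyad_gt0|exact: dyad_le1|move=> z].
set A := average (dyad R m) f.
pose S w := euclid_ball w (dyad R m) `&` [set x | (eta / 2 < `|f x - A w|)%R].
have mS w : measurable (S w).
  apply: measurableI; first exact: measurable_euclid_ball.
  by apply: measurable_gt_norm; exact: measurable_funB.
have mS' w : measurable ((fun x => x + h) @^-1` S w).
  by rewrite -[X in measurable X]setTI; exact: measurable_shift_rV.
apply: (@le_trans _ _ (mu (S z `|` (fun x => x + h) @^-1` S (z + h)))).
  apply: le_measure; rewrite ?inE.
  - apply: measurableI; last exact: measurable_euclid_ball.
    apply: measurable_gt_norm; apply: measurable_funB => //.
    exact: (measurableT_comp mf (measurable_shift_rV h)).
  - exact: measurableU.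
  move=> x [/= Mx zx].
  have [e2x|e2x] := ltP (eta / 2) `|f x - A z|; first by left.
  right; split => /=.
    move: zx; rewrite /euclid_ball/= (_ : x + h - (z + h) = x - z)//.
    by rewrite opprD addrACA subrr addr0.
  have sh := le_trans (average_shift z km hk) (sM m).
  rewrite ltNge; apply/negP => fA.
  move: Mx; apply/negP; rewrite -leNgt.
  rewrite (_ : M + eta = eta / 2 + M + eta / 2); last by field.
  exact: ler_dist3 fA sh e2x.
apply: (le_trans (measureU2 _ _ _)) => //.
rewrite (_ : e * dyad R m ^+ n =
    e / 2 * dyad R m ^+ n + e / 2 * dyad R m ^+ n); last by field.
rewrite EFinD; apply: leeD; first exact: Hm.
by rewrite [leLHS]lebesgue_rVD//; exact: Hm.
Qed.

(** The telescoping starts at the unit ball, because [dyad R 0] is 1. *)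
Lemma ae_norm_le M M0 : (forall z, `|average 1 f z| <= M0) ->
  (forall m, \sum_(0 <= i < m) jump i <= M) ->
  {ae mu, forall x, `|f x| <= M0 + M}.
Proof.
move=> aM sM; apply: ae_le_local => // eta e eta0 e0.
have [m _ Hm] := chebyshev_small sM eta0 e0.
exists (dyad R m); split; [exact: dyad_gt0|exact: dyad_le1|].
move=> z; apply: le_trans (Hm z); apply: le_measure; rewrite ?inE.
- apply: measurableI; last exact: measurable_euclid_ball.
  exact: measurable_gt_norm.
- apply: measurableI; first exact: measurable_euclid_ball.
  by apply: measurable_gt_norm; exact: measurable_funB.
move=> x [/= Mx zx]; split => //=; rewrite ltNge; apply/negP => fA.
move: Mx; apply/negP; rewrite -leNgt.
have := average_telescope z (leq0n m); rewrite {2}/dyad expr0 => tz.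
rewrite (_ : f x = average 1 f z + (average (dyad R m) f z - average 1 f z) +
    (f x - average (dyad R m) f z)); last by ring.
apply: (le_trans (ler_normD _ _)); apply: lerD => //.
apply: (le_trans (ler_normD _ _)); apply: lerD => //.
exact: le_trans tz (sM m).
Qed.

End telescoping.

(** * Modulus of continuity and oscillation *)

Section modulus_bound.
Context (R : realType) (n : nat).
Local Notation mu := (lebesgue_rV R n).
Implicit Types (f g : 'rV[R]_n -> R) (x y z h : 'rV[R]_n) (p r w L : R).

(** The [+oo] case of [Lnorm] branches on whether the whole space has positive measure; this selects
    the essential supremum. *)
Lemma lebesgue_rVT_gt0 : (0 < mu setT)%E.
Proof.
apply: (@lt_le_trans _ _ (mu (euclid_ball 0 1))).
  apply: lt_le_trans (lebesgue_rV_ball_ge 0 ltr01).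
  by rewrite lte_fin mulr_gt0 ?ball_ratio_gt0// exprn_gt0.
by apply: le_measure; rewrite ?inE//; exact: measurable_euclid_ball.
Qed.

Lemma Linf_norm_leP g w :
  (Linf_norm g <= w%:E)%E <-> {ae mu, forall x, `|g x| <= w}.
Proof.
rewrite /Linf_norm unlock lebesgue_rVT_gt0.
split => [/ess_supP|h]; first by apply: filterS => x /=; rewrite lee_fin.
by apply/ess_supP; apply: filterS h => x /=; rewrite lee_fin.
Qed.

Lemma modulus_leP f r w : (modulus f r <= w%:E)%E <->
  forall h, euclid_norm h <= r -> {ae mu, forall x, `|f (x + h) - f x| <= w}.
Proof.
split => [fw h hr|H].
  by apply/Linf_norm_leP; apply: le_trans fw; apply: ereal_sup_ubound; exists h.
by apply: ge_ereal_sup => _ [h hr <-]; apply/Linf_norm_leP; exact: H.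
Qed.

Lemma modulus_le_Linf f r L : (Linf_norm f <= L%:E)%E ->
  (modulus f r <= (2 * L)%:E)%E.
Proof.
move=> /Linf_norm_leP fL; apply/modulus_leP => h _.
apply: filterS2 fL (ae_shift_rV h fL) => x fx fxh.
by rewrite (le_trans (ler_normB _ _))// mulr_natl mulr2n lerD.
Qed.

Lemma le_modulus f r s : r <= s -> (modulus f r <= modulus f s)%E.
Proof.
move=> rs; apply: ereal_sup_le => _ [h /= hr <-]; exists h => //=.
exact: le_trans rs.
Qed.

Lemma integral_powR_ae_le p E g D : 0 <= p -> 0 <= D -> measurable E ->
  measurable_fun setT g ->
  {ae mu, forall x, E x -> `|g x| <= D} ->
  (\int[mu]_(y in E) (`|g y| `^ p)%:E <= (D `^ p)%:E * mu E)%E.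
Proof.
move=> p0 D0 mE mg gD; rewrite -integral_cst//.
apply: ae_ge0_le_integral => //.
- by apply: measurable_funTS; exact: measurable_powR_norm.
- by move=> x _; rewrite lee_fin powR_ge0.
apply: filterS gD => x gx Ex; rewrite lee_fin.
by apply: ge0_ler_powR; rewrite ?nnegrE// gx.
Qed.

Lemma Lp_ball_le_Linf p f x L : 1 <= p -> measurable_fun setT f -> 0 <= L ->
  (Linf_norm f <= L%:E)%E ->
  (Lp_norm p (euclid_ball x 1) f <= (L * (2 ^+ n) `^ p^-1)%:E)%E.
Proof.
move=> p1 mf L0 /Linf_norm_leP fL.
have p0 : 0 < p by exact: lt_le_trans p1.
apply/Lp_norm_leP => //; first by rewrite mulr_ge0 ?powR_ge0.
apply: (le_trans (integral_powR_ae_le (ltW p0) L0 _ mf _)).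
- exact: measurable_euclid_ball.
- by apply: filterS fL => y.
rewrite powRM ?powR_ge0// -powRrM mulVf ?lt0r_neq0// powRr1// EFinM.
rewrite lee_wpmul2l ?lee_fin ?powR_ge0//.
by have := lebesgue_rV_ball_le x (@ler01 R); rewrite mulr1.
Qed.

(* Tonelli picks a center [z] such that [f] deviates little from [f z] a.e. *)
Lemma exists_center f x r w : measurable_fun setT f -> 0 < r ->
  (modulus f (2 * r) <= w%:E)%E ->
  exists z, {ae mu, forall y, euclid_ball x r y -> `|f y - f z| <= w}.
Proof.
move=> mf r0 /modulus_leP fw.
(* Pairs (z, h) with a bad increment. The modulus makes the section null for every fixed h; Tonelli
   turns this into null sections for almost every z. *)
pose D := [set q : 'rV[R]_n * 'rV[R]_n |
  euclid_norm q.2 <= 2 * r /\ w < `|f (q.1 + q.2) - f q.1|].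
have mD : measurable D.
  pose g1 (q : 'rV[R]_n * 'rV[R]_n) : R := euclid_norm q.2.
  pose g2 (q : 'rV[R]_n * 'rV[R]_n) : R := `|f (q.1 + q.2) - f q.1|.
  have mg1 : measurable_fun setT g1.
    exact: (measurableT_comp (@measurable_euclid_norm R n)).
  have mg2 : measurable_fun setT g2.
    apply: measurableT_comp => //; apply: measurable_funB.
      pose s (q : 'rV[R]_n * 'rV[R]_n) : 'rV[R]_n := q.1 + q.2.
      apply: (measurableT_comp (f := f) (g := s)) => //.
      apply/measurable_fun_rVP => i; rewrite /s; under eq_fun do rewrite !mxE.
      by apply: measurable_funD; apply: (measurableT_comp (@measurable_coord_rV R n i)).
    exact: (measurableT_comp (f := f)).
  have -> : D = (g1 @^-1` `]-oo, 2 * r]) `&` (g2 @^-1` `]w, +oo[).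
    by apply/seteqP; split => q; rewrite /D/= !in_itv/= andbT.
  apply: measurableI.
    by rewrite -[X in measurable X]setTI; apply: mg1.
  by rewrite -[X in measurable X]setTI; apply: mg2.
have yD0 h : mu (ysection D h) = 0.
  have [hr|hr] := leP (euclid_norm h) (2 * r).
    apply: measure_negligible; first exact: measurable_ysection.
    apply: negligibleS (fw h hr) => z; rewrite /ysection/= inE => -[_ /= wz].
    by apply/negP; rewrite -ltNge.
  rewrite (_ : ysection D h = set0) ?measure0// -subset0 => z.
  by rewrite /ysection/= inE => -[/= /le_lt_trans/(_ hr)]; rewrite ltxx.
have FT := indic_fubini_tonelli mu mu mD.
rewrite indic_fubini_tonelli_FE// indic_fubini_tonelli_GE//= in FT.
have FT0 : (\int[mu]_z mu (xsection D z) = 0)%E.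
  by rewrite FT; apply: integral0_eq => h _; exact: yD0.
have mx := measurable_fun_xsection mu mD.
have xD0 : {ae mu, forall z, setT z -> mu (xsection D z) = 0}.
  apply/(ae_eq_integral_abs mu measurableT mx).
  by rewrite -[RHS]FT0; apply: eq_integral => z _; rewrite gee0_abs.
(* The ball has positive measure, so it is not contained in the null set of exceptional z. *)
have [z [xz Dz]] : exists z, euclid_ball x r z /\ mu (xsection D z) = 0.
  apply: contrapT => H; have [N [mN N0 sN]] := xD0.
  have : (mu (euclid_ball x r) <= mu N)%E.
    apply: le_measure; rewrite ?inE//; first exact: measurable_euclid_ball.
    by move=> z xz; apply: sN => /(_ I) Dz; apply: H; exists z.
  rewrite N0; apply/negP; rewrite -ltNge.
  apply: lt_le_trans (lebesgue_rV_ball_ge x r0).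
  by rewrite lte_fin mulr_gt0 ?ball_ratio_gt0// exprn_gt0.
exists z; exists ((fun y => y - z) @^-1` xsection D z).
have mxD : measurable (xsection D z) by exact: measurable_xsection.
split.
- by rewrite -[X in measurable X]setTI; exact: measurable_shift_rV.
- by rewrite -Dz; exact: lebesgue_rVD.
move=> y /= /not_implyP[xy /negP]; rewrite -ltNge => wy.
rewrite /xsection/= inE; split => /=; last by rewrite [z + _]addrC subrK.
rewrite (_ : y - z = (y - x) + (x - z)); last by rewrite addrA subrK.
apply: (le_trans (ler_euclid_normD _ _)).
move: xy (euclid_ballC xz); rewrite /euclid_ball/=.
by move: (euclid_norm _) (euclid_norm _) => u v; lra.
Qed.

(** The deviation from f(z) at the center z is at most [w], and then the average is within [2 * w]
    of f(z); hence the 3. The last factor bounds the volume of the ball by that of a cube. *)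
Lemma oscillation_le_modulus p f r w : 1 <= p -> measurable_fun setT f ->
  0 < r -> 0 <= w -> (modulus f (2 * r) <= w%:E)%E ->
  (oscillation p f r <= (3 * w * ((2 * r) ^+ n) `^ p^-1)%:E)%E.
Proof.
move=> p1 mf r0; have p0 : 0 < p by exact: lt_le_trans p1.
set b := _ `^ p^-1; have b0 : 0 < b by rewrite powR_gt0// exprn_gt0// mulr_gt0.
wlog w0 : w / 0 < w => [H w0 h|_ fw].
  apply/lee_addgt0Pr => e e0; rewrite -EFinD.
  have we : 0 < w + e / (3 * b) by rewrite ltr_wpDl// divr_gt0// mulr_gt0.
  rewrite (_ : 3 * w * b + e = 3 * (w + e / (3 * b)) * b); last first.
    by field; rewrite gt_eqF.
  apply: H => //; first exact: ltW.
  by apply: (le_trans h); rewrite lee_fin lerDl divr_ge0 ?mulr_ge0 ?ltW.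
apply/oscillation_leP => //; first by rewrite !mulr_ge0// ltW.
move=> x; have [z fz] := exists_center x mf r0 fw.
set B := euclid_ball x r; have mB : measurable B by exact: measurable_euclid_ball.
have Bfin := fin_num_ball x (ltW r0).
have avg : `|average r f x - f z| <= 2 * w.
  apply: (@average_dist_le _ _ _ _ B f p) => //.
  - exact: measurable_funTS.
  - exact: fine_ball_gt0.
  - by rewrite fineK.
  rewrite EFinM fineK//.
  apply: (@integral_powR_ae_le p B (fun y => f y - f z)) => //; try exact: ltW.
  exact: measurable_funB.
apply: (@le_trans _ _ (((3 * w) `^ p)%:E * mu B)%E).
  apply: integral_powR_ae_le => //; try exact: ltW.
  - by rewrite mulr_ge0// ltW.
  - exact: measurable_funB.
  apply: filterS fz => y /[apply] fyz.
  apply: (le_trans (ler_distD (f z) _ _)).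
  by rewrite (_ : 3 * w = w + 2 * w); [apply: lerD => //; rewrite distrC|ring].
rewrite (@powRM _ (3 * w)) ?(ltW b0) ?mulr_ge0 ?(ltW w0)// EFinM.
rewrite lee_wpmul2l ?lee_fin ?powR_ge0//.
rewrite /b -powRrM mulVf ?lt0r_neq0// powRr1 ?exprn_ge0 ?mulr_ge0 ?(ltW r0)//.
exact: lebesgue_rV_ball_le (ltW r0).
Qed.

End modulus_bound.

(** * Dyadic discretization of the dt/t integrals *)

Section dyadic_integral.
Context (R : realType).
Local Notation leb := (@lebesgue_measure R).
Implicit Types (D : set R) (g : R -> \bar R) (A c : nat -> R) (t : R).

(** Its length is [a], and 1/t lies between 1/(2a) and 1/a on it, so its dt/t mass lies between 1/2
    and 1. *)
Definition block (a : R) : set R := `[a, 2 * a[%classic.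

Lemma measurable_block a : measurable (block a).
Proof. exact: measurable_itv. Qed.

Lemma lebesgue_block a : 0 < a -> leb (block a) = a%:E.
Proof.
move=> a0; rewrite [LHS]lebesgue_measure_itv/= lte_fin ifT.
  by rewrite -EFinB; congr EFin; ring.
by move: a0; lra.
Qed.

(* No measurability is needed: the integral of a nonnegative function is a
   supremum over simple functions. *)
Lemma ge0_le_integral_sup D (f1 f2 : R -> \bar R) :
  (forall t, D t -> (0 <= f1 t)%E) -> (forall t, D t -> (f1 t <= f2 t)%E) ->
  (\int[leb]_(t in D) f1 t <= \int[leb]_(t in D) f2 t)%E.
Proof.
move=> f10 f12.
have f20 t : D t -> (0 <= f2 t)%E by move=> Dt; apply: le_trans (f12 t Dt); exact: f10.
rewrite !ge0_integralE//; apply: ereal_sup_le => _ [h /= hf <-].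
exists h => //= x; apply: (le_trans (hf x)); rewrite !patchE.
by case: ifPn => // /set_mem; exact: f12.
Qed.

Let step A c k t : \bar R := ((c k)%:E * (\1_(block (A k)) t)%:E)%E.

Let step_ge0 A c : (forall k, 0 <= c k) -> forall k t, (0 <= step A c k t)%E.
Proof. by move=> c0 k t; rewrite mule_ge0// lee_fin. Qed.

Let measurable_step A c D k : measurable_fun D (step A c k).
Proof.
apply: measurable_funTS; apply: emeasurable_funM => //.
by apply/measurable_EFinP; exact: measurable_indic (measurable_block _).
Qed.

Let integral_step A c D : measurable D -> (forall k, 0 <= c k) ->
  (\int[leb]_(t in D) (\sum_(k <oo) step A c k t) =
   \sum_(k <oo) ((c k)%:E * leb (block (A k) `&` D)))%E.
Proof.
move=> mD c0; rewrite integral_nneseries//.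
- apply: eq_eseriesr => k _.
  rewrite ge0_integralZl_EFin//.
  + by rewrite integral_indic//; exact: measurable_block.
  + by apply/measurable_EFinP; exact: measurable_indic (measurable_block _).
- by move=> k; exact: measurable_step.
- by move=> k t _; exact: step_ge0.
Qed.

(** On a block 1/t <= 1/A_k, which the length A_k cancels. Blocks may overlap or repeat, since the
    upper bound uses one block containing t. Two families serve two ranges of scales with different
    bounds. *)
Lemma dtt_le D g A1 A2 c1 c2 : measurable D ->
  (forall k, 0 < A1 k) -> (forall k, 0 < A2 k) ->
  (forall k, 0 <= c1 k) -> (forall k, 0 <= c2 k) ->
  (forall t, D t -> (0 <= g t)%E) ->
  (forall t, D t -> (exists k, block (A1 k) t /\ (g t <= (c1 k)%:E)%E) \/
                    (exists k, block (A2 k) t /\ (g t <= (c2 k)%:E)%E)) ->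
  (\int[leb]_(t in D) (g t * t^-1%:E) <=
   \sum_(k <oo) (c1 k)%:E + \sum_(k <oo) (c2 k)%:E)%E.
Proof.
move=> mD A10 A20 c10 c20 g0 cover.
have t0 t : D t -> 0 < t.
  move=> /cover[] [k [+ _]]; rewrite /block/= in_itv/= => /andP[+ _].
    exact: lt_le_trans.
  exact: lt_le_trans.
pose d1 k := c1 k / A1 k; pose d2 k := c2 k / A2 k.
have d10 k : 0 <= d1 k by rewrite divr_ge0// ltW.
have d20 k : 0 <= d2 k by rewrite divr_ge0// ltW.
have one A c d t k : (forall k, 0 < A k) -> (forall k, 0 <= c k) ->
    (forall k, d k = c k / A k) ->
    D t -> block (A k) t -> (g t <= (c k)%:E)%E ->
    (g t * t^-1%:E <= \sum_(k <oo) step A d k t)%E.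
  move=> A0 c0 dE Dt Et gc.
  have d0 j : 0 <= d j by rewrite dE divr_ge0// ltW.
  rewrite (nneseriesD1 (n := k))//; last by move=> j _; exact: step_ge0.
  apply: (@le_trans _ _ (step A d k t)); last first.
    by rewrite leeDl//; apply: nneseries_ge0 => j _ _; exact: step_ge0.
  rewrite /step indicE mem_set// mule1 dE EFinM.
  apply: lee_pmul => //; first exact: g0.
    by rewrite lee_fin invr_ge0 ltW// t0.
  rewrite lee_fin lef_pV2 ?posrE ?A0 ?(t0 t Dt)//.
  by move: Et; rewrite /block/= in_itv/= => /andP[].
have S0 : forall (B e : nat -> R) (t : R), (forall k, 0 <= e k) ->
    (0 <= \sum_(k <oo) step B e k t)%E.
  by move=> B e t e0; apply: nneseries_ge0 => j _ _; exact: step_ge0.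
have mS : forall (B e : nat -> R), (forall k, 0 <= e k) ->
    measurable_fun D (fun t => \sum_(k <oo) step B e k t)%E.
  move=> B e e0; apply: ge0_emeasurable_sum => k; last by move=> _; exact: measurable_step.
  by move=> t _ _; exact: step_ge0.
apply: (@le_trans _ _ (\int[leb]_(t in D)
    ((\sum_(k <oo) step A1 d1 k t) + (\sum_(k <oo) step A2 d2 k t))))%E.
  apply: ge0_le_integral_sup => t Dt.
    by rewrite mule_ge0 ?g0// lee_fin invr_ge0 ltW// t0.
  have [[k [Et gc]]|[k [Et gc]]] := cover t Dt.
    by apply: (le_trans (one A1 c1 d1 t k _ _ _ Dt Et gc)) => //; rewrite leeDl// S0.
  by apply: (le_trans (one A2 c2 d2 t k _ _ _ Dt Et gc)) => //; rewrite leeDr// S0.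
rewrite ge0_integralD//; try (by move=> t _; exact: S0); try exact: mS.
have bd : forall (A d c : nat -> R), (forall k, 0 < A k) ->
    (forall k, 0 <= c k) -> (forall k, d k = c k / A k) ->
    (\int[leb]_(t in D) (\sum_(k <oo) step A d k t) <= \sum_(k <oo) (c k)%:E)%E.
  move=> A d c A0 c0 dE.
  have d0 j : 0 <= d j by rewrite dE divr_ge0// ltW.
  rewrite integral_step//; apply: lee_nneseries => [k _ _|k _].
    by rewrite mule_ge0// lee_fin.
  apply: (@le_trans _ _ ((d k)%:E * (A k)%:E)%E); last first.
    by rewrite -EFinM dE divfK ?gt_eqF.
  rewrite lee_wpmul2l ?lee_fin// -(lebesgue_block (A0 k)).
  apply: le_measure; rewrite ?inE; last exact: subIsetl.
    by apply: measurableI => //; exact: measurable_block.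
  exact: measurable_block.
by apply: leeD; apply: bd.
Qed.

(** On a block 1/t >= 1/(2 A_k), whence the factor 2. The halving condition makes the blocks
    disjoint, so at most one step is nonzero at each t. *)
Lemma dtt_ge D g A c : measurable D ->
  (forall k, 0 < A k) -> (forall k, 2 * A k.+1 <= A k) ->
  (forall k, 0 <= c k) -> (forall k, block (A k) `<=` D) ->
  (forall t, D t -> 0 < t) -> (forall t, D t -> (0 <= g t)%E) ->
  (forall k t, block (A k) t -> ((c k)%:E <= g t)%E) ->
  (\sum_(k <oo) (c k)%:E <= 2%:E * \int[leb]_(t in D) (g t * t^-1%:E))%E.
Proof.
move=> mD A0 A2 c0 AD t0 g0 gc.
pose d k := c k / (2 * A k).
have d0 k : 0 <= d k by rewrite divr_ge0// mulr_ge0// ltW.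
have AA k l : (k < l)%N -> 2 * A l <= A k.
  elim: l => // l IH; rewrite ltnS leq_eqVlt => /predU1P[->//|/IH].
  by move: (A2 l) (A0 l); lra.
have disj k l t : block (A k) t -> block (A l) t -> k = l.
  rewrite /block/= !in_itv/= => /andP[k1 k2] /andP[l1 l2].
  apply/eqP; rewrite eqn_leq; apply/andP; split; rewrite leqNgt; apply/negP => /AA.
    by rewrite leNgt (le_lt_trans l1 k2).
  by rewrite leNgt (le_lt_trans k1 l2).
have -> : (\sum_(k <oo) (c k)%:E =
    2%:E * \int[leb]_(t in D) (\sum_(k <oo) step A d k t))%E.
  rewrite integral_step// -nneseriesZl//; last first.
    by move=> k _; rewrite mule_ge0// lee_fin.
  apply: eq_eseriesr => k _; rewrite setIidl// lebesgue_block// -!EFinM.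
  by congr EFin; rewrite /d; field; rewrite gt_eqF.
rewrite lee_pmul2l//; apply: ge0_le_integral_sup => t Dt.
  by apply: nneseries_ge0 => k _ _; exact: step_ge0.
have [[k Et]|nE] := pselect (exists k, block (A k) t); last first.
  rewrite eseries0 ?mule_ge0 ?g0 ?lee_fin ?invr_ge0 ?(ltW (t0 t Dt))//.
  move=> k _ _; rewrite /step indicE memNset ?mule0// => Et.
  by apply: nE; exists k.
rewrite (nneseriesD1 (n := k))//; last by move=> j _; exact: step_ge0.
rewrite eseries0 ?adde0; last first.
  move=> j _ jk; rewrite /step indicE memNset ?mule0// => Ej.
  by move: jk; rewrite (disj _ _ _ Ej Et) eqxx.
rewrite /step indicE mem_set// mule1 /d EFinM.
apply: lee_pmul => //; rewrite ?lee_fin ?invr_ge0 ?mulr_ge0 ?(ltW (A0 k))//.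
  exact: gc.
have tt := t0 t Dt; rewrite lef_pV2 ?posrE ?mulr_gt0//.
by move: Et; rewrite /block/= in_itv/= => /andP[_ /ltW].
Qed.

End dyadic_integral.

(** * Bounds in l_q and Hardy's inequality *)

Section lq_sequences.
Context (R : realType).
Implicit Types (q : \bar R) (b c : nat -> R) (B z : R) (u : nat -> \bar R).

Lemma nneseries_le u (M : \bar R) : (forall k, (0 <= u k)%E) ->
  (forall m, (\sum_(0 <= k < m) u k <= M)%E) -> (\sum_(k <oo) u k <= M)%E.
Proof.
move=> u0 uM; apply: lime_le; first by apply: is_cvg_nneseries => k _ _; exact: u0.
by apply: nearW => m; exact: uM.
Qed.

Lemma sum_geom_le z m : 0 <= z -> z < 1 ->
  \sum_(0 <= j < m) z ^+ j <= (1 - z)^-1.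
Proof.
move=> z0 z1; have z1' : 1 - z != 0 by rewrite gt_eqF// subr_gt0.
have -> : \sum_(0 <= j < m) z ^+ j = (1 - z ^+ m) / (1 - z).
  elim: m => [|m IH]; first by rewrite big_geq// expr0 subrr mul0r.
  by rewrite big_nat_recr//= IH exprS; field.
by rewrite -[leRHS]mul1r ler_wpM2r ?invr_ge0 ?subr_ge0 ?(ltW z1)// gerBl exprn_ge0.
Qed.

Lemma powRX z r m : 0 <= z -> (z ^+ m) `^ r = (z `^ r) ^+ m :> R.
Proof.
move=> z0; elim: m => [|m IH]; first by rewrite !expr0 powR1.
by rewrite !exprS powRM ?exprn_ge0// IH.
Qed.

(** An l_q bound stated on the power sum, so that no root of a possibly infinite series is taken. *)
Definition lq_le q b B : Prop :=
  match q with
  | r%:E => (\sum_(k <oo) (b k `^ r)%:E <= (B `^ r)%:E)%E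
  | _ => forall k, b k <= B
  end.

(** The r-th root of the factor 2 lost in each passage between a dt/t integral and a sequence. *)
Definition lq_cst q : R := match q with r%:E => 2 `^ r^-1 | _ => 1 end.

Lemma lq_cst_gt0 q : 0 < lq_cst q.
Proof. by case: q => //= r; exact: powR_gt0. Qed.

Let powR_ge0E r b k : (0 <= (b k `^ r)%:E)%E.
Proof. by rewrite lee_fin powR_ge0. Qed.

Lemma lq_le_term q b B : (0 < q)%E -> (forall k, 0 <= b k) -> 0 <= B ->
  lq_le q b B -> forall k, b k <= B.
Proof.
case: q => [r||] //= r0 b0 B0 bB k; rewrite lte_fin in r0.
rewrite leNgt; apply/negP => Bb.
have : (B `^ r < b k `^ r)%R by apply: gt0_ltr_powR; rewrite ?nnegrE.
apply/negP; rewrite -leNgt -lee_fin; apply: le_trans bB.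
rewrite (nneseriesD1 (n := k))//.
by rewrite leeDl//; apply: nneseries_ge0 => j _ _; exact: powR_ge0E.
Qed.

Lemma lq_leZ q b B (a : R) : 0 <= a -> (forall k, 0 <= b k) -> 0 <= B ->
  lq_le q b B -> lq_le q (fun k => a * b k) (a * B).
Proof.
move=> a0 b0 B0; case: q => [r||] /= bB; [|by move=> k; rewrite ler_wpM2l..].
under eq_eseriesr do rewrite powRM// EFinM.
rewrite nneseriesZl; last by move=> j _; exact: powR_ge0E.
by rewrite powRM// EFinM lee_wpmul2l// lee_fin powR_ge0.
Qed.

Lemma lq_le_shift q b B j : lq_le q b B -> lq_le q (fun k => b (k + j)%N) B.
Proof.
case: q => [r||] /= bB; [|by move=> k; exact: bB..].
apply: le_trans bB; rewrite (nneseries_addn j (fun k => powR_ge0E r b k)).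
rewrite [leRHS](nneseries_split 0 j) => [|k _]; last exact: powR_ge0E.
by rewrite add0n leeDr//; apply: sume_ge0 => k _; exact: powR_ge0E.
Qed.

Lemma lq_le_geom q z : (0 < q)%E -> 0 < z -> z < 1 ->
  exists2 G, 0 < G & lq_le q (fun k => z ^+ k) G.
Proof.
move=> q0 z0 z1; case: q q0 => [r||] //= r0; last first.
  by exists 1 => // k; rewrite exprn_ile1// ltW.
rewrite lte_fin in r0.
have zr0 : 0 <= z `^ r by exact: powR_ge0.
have zr1 : z `^ r < 1.
  apply: (@lt_le_trans _ _ (1 `^ r)); last by rewrite powR1.
  by apply: gt0_ltr_powR; rewrite ?nnegrE// ltW.
have H0 : 0 < (1 - z `^ r)^-1 by rewrite invr_gt0 subr_gt0.
exists ((1 - z `^ r)^-1 `^ r^-1); first exact: powR_gt0.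
rewrite -powRrM mulVf ?gt_eqF// powRr1 ?(ltW H0)//.
apply: nneseries_le => [k|m]; first by rewrite lee_fin powR_ge0.
rewrite sumEFin lee_fin; under eq_bigr do rewrite powRX ?(ltW z0)//.
exact: sum_geom_le.
Qed.

(* Hardy's inequality. Splitting the weight [(z ^+ 2) ^+ j] in two equal parts
   bounds the sum by a multiple of its largest term, which treats [q < 1] and
   [1 <= q] alike. *)
Lemma lq_hardy q z : (0 < q)%E -> 0 < z -> z < 1 ->
  exists2 K, 0 < K & forall b B, (forall k, 0 <= b k) -> 0 <= B ->
    lq_le q b B -> exists c, [/\ forall k, 0 <= c k, lq_le q c (K * B) &
      forall k m, \sum_(0 <= j < m) (z ^+ 2) ^+ j * b (j + k)%N <= c k].
Proof.
move=> q0 z0 z1; have [G G0 zG] := lq_le_geom q0 z0 z1.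
have K0 : 0 < (1 - z)^-1 by rewrite invr_gt0 subr_gt0.
have step b k m (V : R) : 0 <= V -> (forall j, z ^+ j * b (j + k)%N <= V) ->
    \sum_(0 <= j < m) (z ^+ 2) ^+ j * b (j + k)%N <= (1 - z)^-1 * V.
  move=> V0 bV; apply: (@le_trans _ _ (\sum_(0 <= j < m) z ^+ j * V)).
    apply: ler_sum_nat => j _; rewrite -exprM mul2n -addnn exprD -mulrA.
    by rewrite ler_wpM2l ?exprn_ge0 ?(ltW z0).
  by rewrite -mulr_suml ler_wpM2r// sum_geom_le// ltW.
case: q q0 zG => [r||] //= r0 zG; last first.
  exists (1 - z)^-1 => // b B b0 B0 bB; exists (fun=> (1 - z)^-1 * B).
  split=> // [k|k m]; first by rewrite mulr_ge0// ltW.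
  apply: step => // j; apply: le_trans (bB (j + k)%N).
  by rewrite ler_piMl// exprn_ile1// ltW.
rewrite lte_fin in r0; exists ((1 - z)^-1 * G); first exact: mulr_gt0.
move=> b B b0 B0 bB.
have zb0 j k : 0 <= z ^+ j * b (j + k)%N by rewrite mulr_ge0// exprn_ge0// ltW.
(* The r-th root of [V k] dominates every term z^j b_(j+k), hence their largest one. *)
pose V k : \bar R := (\sum_(j <oo) ((z ^+ j * b (j + k)%N) `^ r)%:E)%E.
have V0 k : (0 <= V k)%E by apply: nneseries_ge0 => j _ _; rewrite lee_fin powR_ge0.
have sV : (\sum_(k <oo) V k <= ((G * B) `^ r)%:E)%E.
  (* Summing over k first, each j gives (z^j)^r times the power sum of a shift of [b], at most B^r;
     the sum over j is then geometric. *)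
  rewrite nneseries_interchange; last by move=> *; rewrite lee_fin powR_ge0.
  apply: (@le_trans _ _ (\sum_(j <oo) ((B `^ r)%:E * ((z ^+ j) `^ r)%:E))%E).
    apply: lee_nneseries => [j _ _|j _].
      by apply: nneseries_ge0 => k _ _; rewrite lee_fin powR_ge0.
    have zj : 0 <= z ^+ j by rewrite exprn_ge0// ltW.
    under eq_eseriesr do rewrite (powRM _ zj)// EFinM.
    rewrite nneseriesZl; last by move=> *; rewrite lee_fin powR_ge0.
    rewrite muleC lee_wpmul2r ?lee_fin ?powR_ge0//.
    under eq_eseriesr do rewrite addnC.
    exact: (@lq_le_shift r%:E).
  rewrite nneseriesZl; last by move=> *; rewrite lee_fin powR_ge0.
  by rewrite muleC powRM ?(ltW G0)// EFinM lee_wpmul2r ?lee_fin ?powR_ge0.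
have Vfin k : V k \is a fin_num.
  rewrite ge0_fin_numE//; apply: (le_lt_trans _ (ltry ((G * B) `^ r))).
  apply: le_trans sV; rewrite (nneseriesD1 (n := k))//.
  by rewrite leeDl//; apply: nneseries_ge0 => j _ _; exact: V0.
exists (fun k => (1 - z)^-1 * fine (V k) `^ r^-1); split.
- by move=> k; rewrite mulr_ge0 ?powR_ge0// ltW.
- rewrite -mulrA; apply: (@lq_leZ r%:E); rewrite ?mulr_ge0 ?(ltW K0) ?(ltW G0)//.
    by move=> k; exact: powR_ge0.
  move=> /=; under eq_eseriesr do
    rewrite -powRrM mulVf ?gt_eqF// powRr1 ?fine_ge0// fineK//.
  exact: sV.
- move=> k m; apply: step => [|j]; first exact: powR_ge0.
  have -> : z ^+ j * b (j + k)%N = ((z ^+ j * b (j + k)%N) `^ r) `^ r^-1.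
    by rewrite -powRrM mulfV ?gt_eqF// powRr1.
  apply: ge0_ler_powR; rewrite ?nnegrE ?invr_ge0 ?powR_ge0 ?fine_ge0 ?(ltW r0)//.
  rewrite -lee_fin fineK// /V (nneseriesD1 (n := j))//; last first.
    by move=> *; rewrite lee_fin powR_ge0.
  by rewrite leeDl//; apply: nneseries_ge0 => i _ _; rewrite lee_fin powR_ge0.
Qed.

End lq_sequences.

(** * Passage between L_q(dt/t) and l_q *)

Section Lq_dtt_dyadic.
Context (R : realType).
Implicit Types (q : \bar R) (D : set R) (g : R -> \bar R) (A b c : nat -> R) (B S : R).

Lemma Lq_dtt_ge0 q D g : (0 < q)%E -> (forall t, D t -> 0 < t) ->
  (forall t, D t -> (0 <= g t)%E) -> D !=set0 -> (0 <= Lq_dtt q D g)%E.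
Proof.
move=> q0 t0 g0 [t Dt]; case: q q0 => [r||] //= _; first exact: poweR_ge0.
by apply: le_trans (g0 t Dt) _; apply: ereal_sup_ubound; exists t.
Qed.

Lemma Lq_dtt_dyadic_ge q D g A b S : (0 < q)%E -> measurable D ->
  (forall k, 0 < A k) -> (forall k, 2 * A k.+1 <= A k) ->
  (forall k, 0 <= b k) -> (forall k, block (A k) `<=` D) ->
  (forall t, D t -> 0 < t) -> (forall t, D t -> (0 <= g t)%E) ->
  (forall k t, block (A k) t -> ((b k)%:E <= g t)%E) ->
  0 <= S -> (Lq_dtt q D g <= S%:E)%E -> lq_le q b (lq_cst q * S).
Proof.
move=> q0 mD A0 A2 b0 AD t0 g0 bg S0.
have AA k : block (A k) (A k).
  by rewrite /block/= in_itv/= lexx/=; move: (A0 k); lra.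
case: q q0 => [r||] //= r0; last first.
  move=> gS k; rewrite mul1r -lee_fin; apply: le_trans gS.
  apply: (le_trans (bg k _ (AA k))); apply: ereal_sup_ubound.
  by exists (A k) => //; exact: AD (AA k).
rewrite lte_fin in r0; move=> /poweR_inv_leP => /(_ r0).
have J0 : (0 <= \int[lebesgue_measure]_(t in D) (g t `^ r * t^-1%:E))%E.
  apply: integral_ge0 => t Dt; rewrite mule_ge0 ?poweR_ge0// lee_fin invr_ge0 ltW//.
  exact: t0.
move=> /(_ J0 S0) gS.
apply: (@le_trans _ _ (2%:E * \int[lebesgue_measure]_(t in D) (g t `^ r * t^-1%:E))%E).
  apply: (@dtt_ge _ D (fun t => (g t `^ r)%E) A (fun k => b k `^ r)) => //.
  - by move=> k; exact: powR_ge0.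
  - by move=> t _; exact: poweR_ge0.
  move=> k t kt; rewrite -poweR_EFin; apply: gt0_ler_poweR => //; first exact: ltW.
  - by rewrite in_itv/= lee_fin b0 leey.
  - by rewrite in_itv/= leey andbT g0//; exact: AD kt.
  - exact: bg kt.
apply: (@le_trans _ _ (2%:E * (S `^ r)%:E)%E); first by rewrite lee_wpmul2l// lee_fin.
by rewrite powRM ?powR_ge0// -powRrM mulVf ?gt_eqF// powRr1.
Qed.

Lemma Lq_dtt_dyadic_le q D g A1 A2 c1 c2 B1 B2 : (0 < q)%E -> measurable D ->
  (forall k, 0 < A1 k) -> (forall k, 0 < A2 k) ->
  (forall k, 0 <= c1 k) -> (forall k, 0 <= c2 k) -> 0 <= B1 -> 0 <= B2 ->
  (forall t, D t -> 0 < t) -> (forall t, D t -> (0 <= g t)%E) ->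
  (forall t, D t -> (exists k, block (A1 k) t /\ (g t <= (c1 k)%:E)%E) \/
                    (exists k, block (A2 k) t /\ (g t <= (c2 k)%:E)%E)) ->
  lq_le q c1 B1 -> lq_le q c2 B2 ->
  (Lq_dtt q D g <= (lq_cst q * (B1 + B2))%:E)%E.
Proof.
move=> q0 mD A10 A20 c10 c20 B10 B20 t0 g0 cover.
case: q q0 => [r||] //= r0; last first.
  move=> cB1 cB2; apply: ge_ereal_sup => _ [t Dt <-]; rewrite mul1r.
  have [[k [_ gc]]|[k [_ gc]]] := cover t Dt; apply: (le_trans gc); rewrite lee_fin.
    by rewrite (le_trans (cB1 k))// lerDl.
  by rewrite (le_trans (cB2 k))// lerDr.
rewrite lte_fin in r0; move=> cB1 cB2.
have B0 : 0 <= B1 + B2 by rewrite addr_ge0.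
apply/poweR_inv_leP => //; last first.
- apply: (@le_trans _ _ (\sum_(k <oo) (c1 k `^ r)%:E + \sum_(k <oo) (c2 k `^ r)%:E)%E).
    apply: (@dtt_le _ D (fun t => (g t `^ r)%E) A1 A2
      (fun k => c1 k `^ r) (fun k => c2 k `^ r)) => //.
    + by move=> k; exact: powR_ge0.
    + by move=> k; exact: powR_ge0.
    + by move=> t _; exact: poweR_ge0.
    have mono t x : D t -> 0 <= x -> (g t <= x%:E)%E ->
        (g t `^ r <= (x `^ r)%:E)%E.
      move=> Dt cc gc; rewrite -poweR_EFin; apply: gt0_ler_poweR => //; first exact: ltW.
      - by rewrite in_itv/= leey andbT g0.
      - by rewrite in_itv/= lee_fin cc leey.
    move=> t Dt; have [[k [kt gc]]|[k [kt gc]]] := cover t Dt; [left|right];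
      by exists k; split => //; exact: mono.
  apply: (le_trans (leeD cB1 cB2)); rewrite -EFinD lee_fin.
  (* B1^r + B2^r <= 2 (B1 + B2)^r replaces Minkowski's inequality and holds for every r > 0. *)
  rewrite powRM ?powR_ge0// -powRrM mulVf ?gt_eqF// powRr1// mulr_natl mulr2n.
  by apply: lerD; apply: ge0_ler_powR; rewrite ?nnegrE ?(ltW r0)// ?lerDl ?lerDr.
- by rewrite mulr_ge0 ?powR_ge0.
apply: integral_ge0 => t Dt; rewrite mule_ge0 ?poweR_ge0// lee_fin invr_ge0 ltW//.
exact: t0.
Qed.

End Lq_dtt_dyadic.

(** * The two estimates *)

Section dyadic_scale.
Context (R : realType).
Implicit Types (t x y : R).

Lemma powR_dyad k x : dyad R k `^ (- x) = (2 `^ (- x) ^+ k)^-1.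
Proof.
by rewrite /dyad powRX ?invr_ge0// powRV// exprVn.
Qed.

Lemma ler_powRN x y a : 0 <= a -> 0 < x -> x <= y -> y `^ (- a) <= x `^ (- a) :> R.
Proof.
move=> a0 x0 xy; have y0 := lt_le_trans x0 xy.
rewrite !powRN lef_pV2 ?posrE ?powR_gt0//.
by apply: ge0_ler_powR; rewrite ?nnegrE ?(ltW x0) ?(ltW y0).
Qed.

Lemma lt1_dyad_block t : 0 < t -> t < 1 -> exists k, block (dyad R k.+1) t.
Proof.
move=> t0 t1.
have ex : exists k, dyad R k <= t.
  exists (Num.truncn t^-1).+1.
  rewrite /dyad exprVn -[leRHS]invrK lef_pV2 ?posrE ?invr_gt0 ?exprn_gt0//.
  apply: (le_trans (ltW (truncnS_gt _))).
  by rewrite -natrX ler_nat ltnW// ltn_expl.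
case: (ex_minnP ex) => -[|k] kt kmin.
  by move: kt; rewrite /dyad expr0 leNgt t1.
exists k; rewrite /block/= in_itv/= kt dyadS/= ltNge; apply/negP => /kmin.
by rewrite ltnn.
Qed.

Lemma ge1_pow2_block t : 1 <= t -> exists k, block (2 ^+ k) t.
Proof.
move=> t1.
have ex : exists k, t < 2 ^+ k.
  exists (Num.truncn t).+1; apply: (lt_le_trans (truncnS_gt _)).
  by rewrite -natrX ler_nat ltnW// ltn_expl.
case: (ex_minnP ex) => -[|k] kt kmin.
  by move: kt; rewrite expr0 ltNge t1.
exists k; rewrite /block/= in_itv/= -exprS kt andbT leNgt; apply/negP => /kmin.
by rewrite ltnn.
Qed.

End dyadic_scale.

Section nonnegativity.
Context (R : realType) (n : nat).
Implicit Types (f : 'rV[R]_n -> R).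

Lemma Lp_norm_ge0 p D f : (0 <= Lp_norm p D f)%E.
Proof. exact: poweR_ge0. Qed.

Lemma oscillation_ge0 p f r : (0 <= oscillation p f r)%E.
Proof.
apply: le_trans (Lp_norm_ge0 p (euclid_ball 0 r) (fun y => f y - average r f 0)) _.
by apply: ereal_sup_ubound; exists 0.
Qed.

Lemma Linf_norm_ge0 f : (0 <= Linf_norm f)%E.
Proof. exact: Lnorm_ge0. Qed.

Lemma modulus_ge0 f t : 0 <= t -> (0 <= modulus f t)%E.
Proof.
move=> t0; apply: le_trans (Linf_norm_ge0 (fun x => f (x + 0) - f x)) _.
by apply: ereal_sup_ubound; exists 0 => //=; rewrite euclid_norm0.
Qed.

Lemma oscillation_mono_ereal p f s r : 1 <= p -> measurable_fun setT f ->
  0 < s -> s <= r -> (oscillation p f s <= 8%:E * oscillation p f r)%E.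
Proof.
move=> p1 mf s0 sr; have := oscillation_ge0 p f r.
case E : (oscillation p f r) => [x| |] r0; [|by rewrite gt0_muley ?leey|by []].
move: r0; rewrite lee_fin => x0; rewrite -EFinM.
by apply: oscillation_mono sr _ _ => //; rewrite E.
Qed.

Lemma ball_rootE p s : 1 <= p -> 0 < s ->
  ball_root n p s = ball_ratio R n `^ p^-1 * s `^ (n%:R / p).
Proof.
move=> p1 s0; rewrite /ball_root powRM ?exprn_ge0 ?(ltW s0) ?(ltW (ball_ratio_gt0 R n))//.
by rewrite -powR_mulrn ?(ltW s0)// -powRrM.
Qed.

End nonnegativity.

Section campanato_le_besov.
Context (R : realType) (n : nat) (p : R) (q : \bar R) (alpha : R).
Hypotheses (p1 : 1 <= p) (q0 : (0 < q)%E) (a0 : 0 < alpha).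
Local Notation nu := (n%:R / p).
Local Notation theta := (2 `^ (- alpha)).

Let theta_gt0 : 0 < theta. Proof. exact: powR_gt0. Qed.

Lemma theta_lt1 : theta < 1.
Proof.
rewrite powRN invf_lt1 ?powR_gt0//.
apply: (@le_lt_trans _ _ (1 `^ alpha)); first by rewrite powR1.
by apply: gt0_ltr_powR; rewrite ?nnegrE// ltr1n.
Qed.

Let Kq := lq_cst q.

Let Kq0 : 0 < Kq. Proof. exact: lq_cst_gt0. Qed.

(** The volume of the ball contributes t^(n/p), which cancels that part of the weight. *)
Lemma campanato_integrand_le (f : 'rV[R]_n -> R) t w :
  measurable_fun setT f -> 0 < t -> 0 <= w ->
  (modulus f (2 * t) <= w%:E)%E ->
  (((t `^ (- (alpha + nu)))%R)%:E * oscillation p f t <=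
    (t `^ (- alpha) * (3 * 2 `^ nu * w))%:E)%E.
Proof.
move=> mf t0 w0 /(oscillation_le_modulus p1 mf t0 w0) osc.
apply: (le_trans (lee_wpmul2l _ osc)); first by rewrite lee_fin powR_ge0.
rewrite -EFinM lee_fin -powR_mulrn ?mulr_ge0 ?(ltW t0)// -powRrM.
rewrite powRM ?(ltW t0)// opprD powRD; last by apply/implyP => _; rewrite gt_eqF.
rewrite (powRN _ nu).
have tn : t `^ nu != 0 by rewrite gt_eqF// powR_gt0.
by rewrite [leLHS](_ : _ = t `^ (- alpha) * (3 * 2 `^ nu * w))//; field.
Qed.

Lemma campanato_le_besov : exists2 C, 0 < C & forall (f : 'rV[R]_n -> R) S L,
  measurable_fun setT f -> 0 <= S -> 0 <= L -> (Linf_norm f <= L%:E)%E ->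
  (Lq_dtt q `]0%R, 1%R[%classic
     (fun t => ((t `^ (- alpha))%R%:E * modulus f t)%E) <= S%:E)%E ->
  (campanato_norm p q (alpha + nu) f <= (C * (S + L))%:E)%E.
Proof.
have [G G0 thG] := lq_le_geom q0 theta_gt0 theta_lt1.
pose M1 := 3 * 2 `^ nu * theta ^- 3.
pose M2 := 3 * 2 `^ nu * 2 * 4^-1 `^ (- alpha).
pose M3 : R := (2 ^+ n) `^ p^-1.
have M10 : 0 < M1 by rewrite !mulr_gt0 ?invr_gt0 ?exprn_gt0 ?powR_gt0.
have M20 : 0 < M2 by rewrite !mulr_gt0 ?powR_gt0 ?invr_gt0.
have M30 : 0 < M3 by rewrite powR_gt0// exprn_gt0.
exists (Kq * (M1 * Kq) + Kq * (M2 * G) + M3).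
  by rewrite !addr_gt0 ?mulr_gt0.
move=> f S L mf S0 L0 fL fS.
have wfin t : 0 <= t -> modulus f t \is a fin_num.
  move=> t0; rewrite ge0_fin_numE ?modulus_ge0//.
  exact: le_lt_trans (modulus_le_Linf t fL) (ltry _).
pose w k := fine (modulus f (dyad R k)).
have wE k : modulus f (dyad R k) = (w k)%:E.
  by rewrite fineK// wfin// ltW// dyad_gt0.
have w0 k : 0 <= w k by rewrite fine_ge0// modulus_ge0// ltW// dyad_gt0.
(* A lower bound of the Besov integrand on [r_(m+1), r_m): the modulus is taken at the left end and
   the decreasing weight at the right end. *)
pose b m := theta ^- m * w m.+1.
have b0 m : 0 <= b m by rewrite mulr_ge0// invr_ge0 exprn_ge0// ltW.
have bS : lq_le q b (Kq * S).
  apply: (@Lq_dtt_dyadic_ge _ q _ _ (fun k => dyad R k.+1) b S) fS => //.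
  - by move=> k; exact: dyad_gt0.
  - by move=> k; rewrite dyadS.
  - move=> k t; rewrite /block/= !in_itv/= dyadS => /andP[kt tk].
    by rewrite (lt_le_trans (dyad_gt0 R k.+1) kt) (lt_le_trans tk (dyad_le1 R k)).
  - by move=> t /=; rewrite in_itv/= => /andP[].
  - move=> t /=; rewrite in_itv/= => /andP[t0 _].
    by rewrite mule_ge0 ?lee_fin ?powR_ge0 ?modulus_ge0// ltW.
  - move=> k t; rewrite /block/= in_itv/= dyadS => /andP[kt tk].
    rewrite /b EFinM -wE; apply: lee_pmul.
    + by rewrite lee_fin invr_ge0 exprn_ge0// ltW.
    + by rewrite modulus_ge0// ltW// dyad_gt0.
    + rewrite lee_fin -powR_dyad; apply: ler_powRN; first exact: ltW.
        exact: lt_le_trans (dyad_gt0 R k.+1) kt.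
      exact: ltW.
    + exact: le_modulus.
have S1 : (campanato_seminorm p q (alpha + nu) f <=
    (Kq * (M1 * (Kq * S) + M2 * L * G))%:E)%E.
  apply: (@Lq_dtt_dyadic_le _ q _ _ (fun k => dyad R k.+3) (fun k => 2 ^+ k / 4)
    (fun k => M1 * b k) (fun k => M2 * L * theta ^+ k)) => //.
  - by move=> k; exact: dyad_gt0.
  - by move=> k /=; rewrite mulr_ge0// ltW.
  - by move=> k /=; rewrite !mulr_ge0 ?exprn_ge0// ltW.
  - by rewrite !mulr_ge0// ltW.
  - by rewrite !mulr_ge0// ltW.
  - by move=> t /=; rewrite in_itv/= andbT.
  - by move=> t _; rewrite mule_ge0 ?lee_fin ?powR_ge0 ?oscillation_ge0.
  - move=> t /=; rewrite in_itv/= andbT => t0.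
    have t40 : 0 < 4 * t by rewrite mulr_gt0.
    (* The oscillation at t uses the modulus at 2t. If r_(k+1) <= 4t < r_k, then 2t < r_(k+1) and t
       lies in the block of r_(k+3), whence theta^(-3) in [M1]. From t = 1/4 on, the modulus is
       bounded by [2 * L]. *)
    have [t1|t1] := ltP (4 * t) 1.
      left; have [k tk] := lt1_dyad_block t40 t1.
      move: tk; rewrite /block/= in_itv/= dyadS => /andP[kt tk].
      have d2 := dyadS R k; have d3 := dyadS R k.+1; have d4 := dyadS R k.+2.
      exists k; split; first by rewrite in_itv/=; apply/andP; split; lra.
      have fw : (modulus f (2 * t) <= (w k.+1)%:E)%E.
        by rewrite -wE; apply: le_modulus; lra.
      apply: (le_trans (campanato_integrand_le mf t0 (w0 _) fw)).
      rewrite lee_fin.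
      rewrite (_ : M1 * b k = dyad R k.+3 `^ (- alpha) * (3 * 2 `^ nu * w k.+1)).
        rewrite ler_wpM2r ?mulr_ge0 ?powR_ge0//.
        by apply: ler_powRN; [exact: ltW|exact: dyad_gt0|lra].
      rewrite powR_dyad /M1 /b (_ : k.+3 = 3 + k)%N// exprD.
      by field; rewrite expf_neq0 ?gt_eqF.
    right; have [j tj] := ge1_pow2_block t1.
    move: tj; rewrite /block/= in_itv/= => /andP[jt tj].
    have j0 : 0 < 2 ^+ j / 4 :> R by rewrite divr_gt0// exprn_gt0.
    exists j; split.
      by rewrite in_itv/=; apply/andP; split; move: jt tj; set u := 2 ^+ j; lra.
    have fw : (modulus f (2 * t) <= (2 * L)%:E)%E by exact: modulus_le_Linf.
    apply: (le_trans (campanato_integrand_le mf t0 _ fw)); first by rewrite mulr_ge0.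
    rewrite lee_fin.
    rewrite (_ : M2 * L * _ = (2 ^+ j / 4) `^ (- alpha) * (3 * 2 `^ nu * (2 * L))).
      rewrite ler_wpM2r ?mulr_ge0 ?powR_ge0//.
      apply: ler_powRN; [exact: ltW|exact: j0|].
      by move: jt; set u := 2 ^+ j; lra.
    rewrite powRM ?exprn_ge0 ?invr_ge0// powRX// /M2; ring.
  - by apply: lq_leZ; [exact: ltW|exact: b0|rewrite mulr_ge0// ltW|exact: bS].
  - apply: lq_leZ; [by rewrite mulr_ge0// ltW| |exact: ltW|exact: thG].
    by move=> k; rewrite exprn_ge0// ltW.
rewrite /campanato_norm.
apply: (@le_trans _ _ ((Kq * (M1 * (Kq * S) + M2 * L * G))%:E + (L * M3)%:E)%E).
  apply: leeD; first exact: S1.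
  by apply: ge_ereal_sup => _ [x _ <-]; exact: Lp_ball_le_Linf.
rewrite -EFinD lee_fin.
(* The right-hand side exceeds the bound obtained by nonnegative cross terms in S and L. *)
rewrite [leRHS](_ : _ = (Kq * (M1 * (Kq * S) + M2 * L * G) + L * M3) +
   (Kq * (M1 * Kq) * L + Kq * (M2 * G) * S + M3 * S)); last by ring.
by rewrite lerDl !addr_ge0// !mulr_ge0// ltW.
Qed.

End campanato_le_besov.

Section besov_le_campanato.
Context (R : realType) (n : nat) (p : R) (q : \bar R) (alpha : R).
Hypotheses (p1 : 1 <= p) (q0 : (0 < q)%E) (a0 : 0 < alpha).
Local Notation mu := (lebesgue_rV R n).
Local Notation nu := (n%:R / p).
Local Notation lambda := (alpha + nu).
Local Notation theta := (2 `^ (- alpha)).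

Let p0 : 0 < p. Proof. exact: lt_le_trans p1. Qed.

Let nu0 : 0 <= nu. Proof. by rewrite divr_ge0// ltW. Qed.

Let l0 : 0 <= lambda. Proof. by rewrite addr_ge0// ltW. Qed.

Let theta_gt0 : 0 < theta. Proof. exact: powR_gt0. Qed.

Let Kq := lq_cst q.

Let Kq0 : 0 < Kq. Proof. exact: lq_cst_gt0. Qed.

Lemma norm_average1_le (f : 'rV[R]_n -> R) N z : measurable_fun setT f -> 0 <= N ->
  (forall x, (Lp_norm p (euclid_ball x 1) f <= N%:E)%E) ->
  `|average 1 f z| <= 2 * (N / ball_root n p 1).
Proof.
move=> mf N0 fN; have r0 := @ball_root_gt0 R n p 1 ltr01.
apply/ler_addgt0Pr => e e0.
have Ne : 0 < N + e * (ball_root n p 1 / 2) by rewrite ltr_wpDl// mulr_gt0// divr_gt0.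
have -> : 2 * (N / ball_root n p 1) + e =
    2 * ((N + e * (ball_root n p 1 / 2)) / ball_root n p 1).
  by field; rewrite gt_eqF.
rewrite -[average 1 f z]subr0.
apply: (le_trans (average_sub_ball p1 mf ltr01 Ne (@subset_refl _ (euclid_ball z 1)) _)).
  under eq_integral do rewrite subr0.
  apply/Lp_norm_leP => //; first exact: ltW.
  by apply: (le_trans (fN z)); rewrite lee_fin lerDl mulr_ge0 ?divr_ge0 ?ltW.
rewrite ler_pM2l// ler_pM2l// lef_pV2 ?posrE//.
  exact: ball_root_le.
exact/powR_gt0/fine_ball_gt0.
Qed.

(** An infinite value at r_k would, by the comparison with factor 8, be infinite at all larger
    radii, in particular on a whole block. A sequence with the single value [M], larger than the l_q
    bound permits, then gives the contradiction. *)
Lemma dyadic_oscillation_fin_num (f : 'rV[R]_n -> R) S k : measurable_fun setT f ->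
  0 <= S -> (campanato_seminorm p q lambda f <= S%:E)%E ->
  oscillation p f (dyad R k) \is a fin_num.
Proof.
move=> mf S0 fS; rewrite ge0_fin_numE ?oscillation_ge0// ltNge leye_eq.
apply/negP => /eqP kS.
have d0 := dyad_gt0 R.
pose M := Kq * S + 1; have M0 : 0 <= M by rewrite addr_ge0// mulr_ge0// ltW.
pose b j : R := if j == k then M else 0.
have b0 j : 0 <= b j by rewrite /b; case: ifP.
suff : lq_le q b (Kq * S).
  move=> /(lq_le_term q0 b0 (mulr_ge0 (ltW Kq0) S0))/(_ k).
  by rewrite /b eqxx /M leNgt ltrDl ltr01.
apply: (@Lq_dtt_dyadic_ge _ q _ _ (dyad R) b S) fS => //.
- by move=> j; rewrite dyadS.
- move=> j t; rewrite /block/= !in_itv/= andbT => /andP[jt _].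
  exact: lt_le_trans jt.
- by move=> t /=; rewrite in_itv/= andbT.
- by move=> t _; rewrite mule_ge0 ?lee_fin ?powR_ge0 ?oscillation_ge0.
move=> j t; rewrite /block/= in_itv/= /b => /andP[jt tj].
have t0 := lt_le_trans (d0 j) jt.
case: eqP => [jk|_]; last by rewrite mule_ge0 ?lee_fin ?powR_ge0 ?oscillation_ge0.
rewrite jk in jt.
have := oscillation_mono_ereal p1 mf (d0 k) jt; rewrite kS leye_eq => /eqP.
case: (oscillation p f t) (oscillation_ge0 p f t) => [x| |] //= _ _.
by rewrite gt0_muley ?leey// lte_fin powR_gt0.
Qed.

Lemma besov_le_campanato : exists2 C, 0 < C & forall (f : 'rV[R]_n -> R) S N,
  measurable_fun setT f -> 0 <= S -> 0 <= N ->
  (forall x, (Lp_norm p (euclid_ball x 1) f <= N%:E)%E) ->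
  (campanato_seminorm p q lambda f <= S%:E)%E ->
  (besov_norm q alpha f <= (C * (S + N))%:E)%E.
Proof.
have th1 := theta_lt1 a0.
have [G G0 thG] := lq_le_geom q0 theta_gt0 th1.
(* [lq_hardy] carries the weight z^2, which has to be theta. *)
pose z : R := 2 `^ (- (alpha / 2)).
have z0 : 0 < z by exact: powR_gt0.
have zth : z ^+ 2 = theta.
  rewrite -powR_mulrn ?(ltW z0)// /z -powRrM; congr (_ `^ _); by field.
have z1 : z < 1 by apply: theta_lt1; rewrite divr_gt0.
have [H H0 hardy] := lq_hardy q0 z0 z1.
have rr0 := @ball_root_gt0 R n p 1 ltr01.
have v0 : 0 < ball_ratio R n `^ p^-1 by rewrite powR_gt0// ball_ratio_gt0.
(* The 8 comes from comparing oscillations at r_k and at t in the block, the power of 2 from t < 2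
   r_k in the weight. *)
pose M0 : R := 8 * 2 `^ lambda.
pose c1 : R := 2 * 2 `^ nu / ball_ratio R n `^ p^-1.
have M00 : 0 < M0 by rewrite mulr_gt0// powR_gt0.
have c10 : 0 < c1 by rewrite !mulr_gt0 ?powR_gt0 ?invr_gt0.
pose P := H * M0 * Kq.
have P0 : 0 < P by rewrite !mulr_gt0.
pose Q := 2 / ball_root n p 1.
have Q0 : 0 < Q by rewrite divr_gt0.
pose T := 2 * theta^-1 * G.
have T0 : 0 < T by rewrite !mulr_gt0 ?invr_gt0.
exists (Kq * (2 * c1 * theta ^- 2 * P) + (Kq * T + 1) * (Q + c1 * P)).
  rewrite addr_gt0// ?mulr_gt0 ?invr_gt0 ?exprn_gt0// addr_gt0// mulr_gt0//.
move=> f S N mf S0 N0 fN fS.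
have d0 := dyad_gt0 R.
pose o k := fine (oscillation p f (dyad R k)).
have oE k : oscillation p f (dyad R k) = (o k)%:E.
  by rewrite fineK//; exact: dyadic_oscillation_fin_num fS.
have o0 k : 0 <= o k by rewrite fine_ge0// oscillation_ge0.
have oo k : (oscillation p f (dyad R k) <= (o k)%:E)%E by rewrite oE.
pose b k := dyad R k `^ (- lambda) * o k.
have b0 k : 0 <= b k by rewrite mulr_ge0// powR_ge0.
have bS : lq_le q b (M0 * (Kq * S)).
  have -> : b = (fun k => M0 * (M0^-1 * b k)).
    by apply/funext => k; rewrite mulrA mulfV ?mul1r// gt_eqF.
  have mb0 k : 0 <= M0^-1 * b k by rewrite mulr_ge0// invr_ge0 ltW.
  apply: lq_leZ; [exact: ltW|exact: mb0|by rewrite mulr_ge0// ltW|].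
  apply: (@Lq_dtt_dyadic_ge _ q _ _ (dyad R) _ S) fS => //.
  - by move=> j; rewrite dyadS.
  - move=> j t; rewrite /block/= !in_itv/= andbT => /andP[jt _].
    exact: lt_le_trans jt.
  - by move=> t /=; rewrite in_itv/= andbT.
  - by move=> t _; rewrite mule_ge0 ?lee_fin ?powR_ge0 ?oscillation_ge0.
  move=> j t; rewrite /block/= in_itv/= => /andP[jt tj].
  have t0 := lt_le_trans (d0 j) jt.
  rewrite (_ : M0^-1 * b j = (2 * dyad R j) `^ (- lambda) * (8^-1 * o j)); last first.
    rewrite /M0 /b powRM ?(ltW (d0 _))// (powRN 2).
    by field; rewrite gt_eqF// powR_gt0.
  rewrite EFinM; apply: lee_pmul.
  - by rewrite lee_fin powR_ge0.
  - by rewrite lee_fin mulr_ge0.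
  - by rewrite lee_fin; apply: ler_powRN => //; exact: ltW.
  have := oscillation_mono_ereal p1 mf (d0 j) jt; rewrite oE => ot.
  by rewrite -(@lee_pmul2l _ 8%:E)// -EFinM mulrA mulfV// mul1r.
have B0 : 0 <= M0 * (Kq * S) by rewrite !mulr_ge0// ltW.
have [c [c0 cS bc]] := hardy b _ b0 B0 bS.
rewrite (_ : H * (M0 * (Kq * S)) = P * S) in cS; last by rewrite /P; ring.
have PS0 : 0 <= P * S by rewrite mulr_ge0// ltW.
(* The geometric weight appears here: r_k^(-n/p) = r_k^alpha r_k^(-lambda), and r_k^alpha =
   theta^k. *)
have jumpE k : jump n p o k = c1 * (theta ^+ k * b k).
  rewrite /jump ball_rootE//.
  have -> : dyad R k.+1 = 2^-1 * dyad R k by rewrite -(dyadS R k) mulrA mulVf ?mul1r.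
  rewrite powRM ?(ltW (d0 _))// powRV// /b opprD powRD; last first.
    by apply/implyP => _; rewrite gt_eqF.
  rewrite powR_dyad (powRN _ nu) /c1.
  by field; rewrite !gt_eqF ?powR_gt0 ?exprn_gt0 ?ball_ratio_gt0.
have jumps k m : \sum_(k <= i < m) jump n p o i <= c1 * (theta ^+ k * c k).
  under eq_bigr do rewrite jumpE.
  rewrite -mulr_sumr ler_pM2l// -{1}[k]add0n big_addn.
  rewrite (eq_bigr (fun i => theta ^+ k * (theta ^+ i * b (i + k)%N))); last first.
    by move=> i _; rewrite exprD; ring.
  rewrite -mulr_sumr ler_pM2l ?exprn_gt0//.
  by have := bc k (m - k)%N; rewrite zth.
have fmod k : (modulus f (dyad R k.+1) <= (2 * (c1 * (theta ^+ k * c k)))%:E)%E.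
  apply/modulus_leP => h hk; apply: (ae_shift_le p1 mf o0 oo hk) => m.
  by rewrite ler_pM2l.
pose L := Q * N + c1 * (P * S).
have L0 : 0 <= L by rewrite addr_ge0// mulr_ge0// ltW.
have fL : (Linf_norm f <= L%:E)%E.
  apply/Linf_norm_leP.
  apply: (ae_norm_le p1 mf o0 oo (M0 := Q * N) (M := c1 * (P * S))).
    by move=> y; have := norm_average1_le y mf N0 fN; rewrite /Q mulrA mulrAC.
  move=> m; apply: (le_trans (jumps 0%N m)); rewrite expr0 mul1r ler_pM2l//.
  exact: (lq_le_term q0 c0 PS0 cS).
have S1 : (Lq_dtt q `]0%R, 1%R[%classic
     (fun t => ((t `^ (- alpha))%R%:E * modulus f t)%E) <=
    (Kq * (2 * c1 * theta ^- 2 * (P * S) + 2 * theta^-1 * L * G))%:E)%E.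
  have k20 : 0 <= 2 * c1 * theta ^- 2.
    by rewrite !mulr_ge0 ?invr_ge0 ?exprn_ge0// ltW.
  have k10 : 0 <= 2 * theta^-1 * L by rewrite !mulr_ge0 ?invr_ge0// ltW.
  apply: (@Lq_dtt_dyadic_le _ q _ _ (fun k => dyad R k.+2) (fun k => dyad R 1)
    (fun k => 2 * c1 * theta ^- 2 * c k) (fun k => 2 * theta^-1 * L * theta ^+ k)) => //.
  - by move=> k; rewrite mulr_ge0.
  - by move=> k; rewrite mulr_ge0// exprn_ge0// ltW.
  - by rewrite mulr_ge0.
  - by rewrite mulr_ge0// ltW.
  - by move=> t /=; rewrite in_itv/= => /andP[].
  - move=> t /=; rewrite in_itv/= => /andP[t0 _].
    by rewrite mule_ge0 ?lee_fin ?powR_ge0 ?modulus_ge0// ltW.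
  - move=> t /=; rewrite in_itv/= => /andP[t0 t1].
    (* [fmod] starts at radius 1/2, so the block [1/2, 1) uses the L_infty bound. The second family
       repeats this block, and its index 0 alone is used. *)
    have [[|k] tk] := lt1_dyad_block t0 t1.
      right; exists 0%N; split => //.
      apply: (@le_trans _ _ (theta^-1%:E * (2 * L)%:E)%E); last first.
        by rewrite -EFinM lee_fin expr0 mulr1 mulrCA mulrA.
      apply: lee_pmul; rewrite ?lee_fin ?powR_ge0 ?modulus_ge0 ?(ltW t0)//.
        rewrite -[theta]expr1 -powR_dyad; apply: ler_powRN => //; first exact: ltW.
        by move: tk; rewrite /block/= in_itv/= => /andP[].
      exact: modulus_le_Linf.
    left; exists k; split => //.
    move: tk; rewrite /block/= in_itv/= dyadS => /andP[kt tk].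
    (* For t in [r_(k+2), r_(k+1)) the weight is taken at the left end and the modulus at the right
       end; the mismatch of indices leaves theta^(-2). *)
    apply: (@le_trans _ _ ((theta ^- k.+2)%:E * (2 * (c1 * (theta ^+ k * c k)))%:E)%E).
      apply: lee_pmul; rewrite ?lee_fin ?powR_ge0 ?modulus_ge0 ?(ltW t0)//.
        by rewrite -powR_dyad; apply: ler_powRN => //; exact: ltW.
      by apply: le_trans (fmod k); apply: le_modulus; exact: ltW.
    rewrite -EFinM lee_fin (_ : k.+2 = 2 + k)%N// exprD.
    rewrite [leLHS](_ : _ = 2 * c1 * theta ^- 2 * c k)//.
    by field; rewrite expf_neq0 ?gt_eqF.
  - exact: lq_leZ.
  - apply: lq_leZ; [exact: k10| |exact: ltW|exact: thG].
    by move=> k; rewrite exprn_ge0// ltW.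
apply: (le_trans (leeD S1 fL)); rewrite -EFinD lee_fin.
set D := 2 * c1 * theta ^- 2; have : 0 < D by rewrite !mulr_gt0 ?invr_gt0 ?exprn_gt0.
move: D => D D0.
rewrite [leRHS](_ : _ = (Kq * (D * (P * S) + 2 * theta^-1 * L * G) + L) +
   (Kq * (D * P) * N + (Kq * T + 1) * (Q * S + c1 * P * N))); last first.
  by rewrite /L /T; ring.
rewrite lerDl addr_ge0//; first by rewrite !mulr_ge0// ltW.
apply: mulr_ge0; apply: addr_ge0.
- exact: ltW (mulr_gt0 Kq0 T0).
- exact: ler01.
- exact: mulr_ge0 (ltW Q0) S0.
- exact: mulr_ge0 (ltW (mulr_gt0 c10 P0)) N0.
Qed.

End besov_le_campanato.

Theorem proposition3p11 (R : realType) (n : nat) (p : R) (q : \bar R)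
    (lambda alpha : R) (hn : (1 <= n)%N) (hp : 1 <= p) (hq : (0 < q)%E)
    (hlambda : n%:R / p < lambda < n%:R / p + 1)
    (halpha : alpha = lambda - n%:R / p) :
  exists c C : R, [/\ 0 < c, 0 < C &
    forall f : 'rV[R]_n -> R, Lp_loc p f ->
      (c%:E * besov_norm q alpha f <= campanato_norm p q lambda f)%E /\
      (campanato_norm p q lambda f <= C%:E * besov_norm q alpha f)%E].
Proof.
have a0 : 0 < alpha by rewrite halpha subr_gt0; case/andP: hlambda.
have lE : lambda = alpha + n%:R / p by rewrite halpha subrK.
have [C1 C10 H1] := @campanato_le_besov R n p q alpha hp hq a0.
have [C2 C20 H2] := @besov_le_campanato R n p q alpha hp hq a0.
exists C2^-1, C1; split => //; first by rewrite invr_gt0.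
move=> f [mf _]; rewrite lE; split.
- rewrite /campanato_norm; set s := campanato_seminorm _ _ _ _; set N := ereal_sup _.
  have s0 : (0 <= s)%E.
    apply: Lq_dtt_ge0 => //.
    + by move=> t /=; rewrite in_itv/= andbT.
    + by move=> t _; rewrite mule_ge0 ?lee_fin ?powR_ge0 ?oscillation_ge0.
    + by exists 1; rewrite /= in_itv/= ltr01.
  have N0 : (0 <= N)%E.
    apply: le_trans (Lp_norm_ge0 p (euclid_ball 0 1) f) _.
    by apply: ereal_sup_ubound; exists 0.
  (* An infinite Campanato norm makes the inequality trivial; a finite one makes both of its
     nonnegative parts real, as [H2] demands. *)
  have [sN|] := ltP (s + N)%E +oo%E; last by rewrite leye_eq => /eqP ->; rewrite leey.
  have sf : s \is a fin_num.
    by rewrite ge0_fin_numE//; apply: le_lt_trans sN; rewrite leeDl.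
  have Nf : N \is a fin_num.
    by rewrite ge0_fin_numE//; apply: le_lt_trans sN; rewrite leeDr.
  have := H2 f (fine s) (fine N) mf (fine_ge0 s0) (fine_ge0 N0).
  rewrite !fineK// => /(_ _ (lexx _)) H.
  rewrite -[leRHS](fineK (_ : _ \is a fin_num)) ?fin_numD ?sf// fineD//.
  have -> : (fine s + fine N)%:E = (C2^-1%:E * (C2 * (fine s + fine N))%:E)%E.
    by rewrite -EFinM mulrA mulVf ?mul1r// gt_eqF.
  apply: lee_wpmul2l; first by rewrite lee_fin invr_ge0 ltW.
  apply: H => x; apply: ereal_sup_ubound; by exists x.
rewrite /besov_norm; set s := Lq_dtt _ _ _; set L := Linf_norm f.
have s0 : (0 <= s)%E.
  apply: Lq_dtt_ge0 => //.
  + by move=> t /=; rewrite in_itv/= => /andP[].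
  + move=> t /=; rewrite in_itv/= => /andP[t0 _].
    by rewrite mule_ge0 ?lee_fin ?powR_ge0 ?modulus_ge0// ltW.
  + by exists 2^-1; rewrite /= in_itv/= invr_gt0 invf_lt1// ltr1n ltr0n.
have L0 : (0 <= L)%E by exact: Linf_norm_ge0.
have [sL|] := ltP (s + L)%E +oo%E; last first.
  by rewrite leye_eq => /eqP ->; rewrite gt0_muley ?leey.
have sf : s \is a fin_num.
  by rewrite ge0_fin_numE//; apply: le_lt_trans sL; rewrite leeDl.
have Lf : L \is a fin_num.
  by rewrite ge0_fin_numE//; apply: le_lt_trans sL; rewrite leeDr.
have := H1 f (fine s) (fine L) mf (fine_ge0 s0) (fine_ge0 L0).
by rewrite !fineK// => /(_ (lexx _) (lexx _)); rewrite EFinM EFinD !fineK.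
Qed.
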